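(* Let $B\in(0,1]$, $\alpha\ge0$ and $\alpha_f\ge\alpha$. The asymptotic matching rate of the two-sided allocation satisfies $$\eta_{\mathrm{TS}}(B,\alpha,\alpha_f)=1-\max_{t_1,t_2\in[0,1]}F_{\mathrm{TS}}(t_1,t_2),$$ where $$\begin{aligned}F_{\mathrm{TS}}(t_1,t_2)={}&\Big(1-\frac B2\Big)\exp\Big(-2\alpha\big(1-\tfrac B2\big)e^{-M_1t_1}-(\alpha+\alpha_f)\tfrac B2\,e^{-M_2t_2}\Big)\\&+\frac B2\exp\Big(-(\alpha+\alpha_f)\big(1-\tfrac B2\big)e^{-M_1t_1}-\alpha_fB\,e^{-M_2t_2}\Big)\\&+\Big(1-\frac B2\Big)e^{-M_1t_1}(1+M_1t_1)+\frac B2\,e^{-M_2t_2}(1+M_2t_2)-1,\end{aligned}$$ with $M_1=\left(2-\frac B2\right)\alpha+\frac B2\alpha_f$ and $M_2=\left(1-\frac B2\right)\alpha+\left(1+\frac B2\right)\alpha_f$.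
   Context: For $b^{\mathrm L},b^{\mathrm R}\in[0,1]$ and a $2\times2$ matrix $\mathbf C=[c_{xy}]$ with non-negative entries, $G_n$ is the random bipartite graph with $n$ supply and $n$ demand nodes in which, independently over nodes, each supply node is of type 2 (flexible) with probability $b^{\mathrm L}$ and of type 1 (regular) otherwise, each demand node is of type 2 with probability $b^{\mathrm R}$ and of type 1 otherwise, and, conditional on types, a supply node of type $x$ and a demand node of type $y$ are connected independently with probability $c_{xy}/n$ ($n$ large). $M_\star(G_n)$ is the maximum matching size and $\eta(b^{\mathrm L},b^{\mathrm R};\mathbf C)=\lim_{n\to\infty}\mathbb E[M_\star(G_n)]/n$ (the limit exists). In the flexibility design problem, $\mathbf C=\begin{bmatrix}2\alpha&\alpha+\alpha_f\\ \alpha+\alpha_f&2\alpha_f\end{bmatrix}$, and the two-sided allocation with budget $B$ is $(b^{\mathrm L},b^{\mathrm R})=(B/2,B/2)$, so $\eta_{\mathrm{TS}}(B,\alpha,\alpha_f)=\eta(B/2,B/2;\mathbf C)$. *)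

(* Defs.v *)
From HB Require Import structures.
From mathcomp Require Import all_boot all_order all_algebra.
From mathcomp Require Import all_classical all_reals all_analysis.

Set Implicit Arguments.
Unset Strict Implicit.
Unset Printing Implicit Defensive.

Import Order.TTheory GRing.Theory Num.Theory.
Import numFieldNormedType.Exports.

Local Open Scope classical_set_scope.
Local Open Scope ring_scope.

(* A bipartite graph with n supply and n demand nodes is its edge set; an edge
   is a pair (supply node, demand node). *)
Definition bigraph (n : nat) : finType := {set 'I_n * 'I_n}.

Definition is_matching (n : nat) (G : bigraph n) (M : {set 'I_n * 'I_n}) : bool :=
  (M \subset G) &&
  [forall e in M, forall f in M, ((e.1 == f.1) || (e.2 == f.2)) ==> (e == f)].

Definition max_matching (n : nat) (G : bigraph n) : nat :=
  (\max_(M : {set 'I_n * 'I_n} | is_matching G M) #|M|)%N.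

(* Node types are indices in 'I_2: 0 is regular (type 1), 1 is flexible
   (type 2). *)
Definition type_prob (R : realType) (b : R) (x : 'I_2) : R :=
  if x == 0 then 1 - b else b.

(* The truncation at 1 only matters for the finitely many n < C x y. *)
Definition edge_prob (R : realType) (C : 'M[R]_2) (n : nat) (x y : 'I_2) : R :=
  Num.min 1 (C x y / n%:R).

(* Joint probability of supply types tL, demand types tR and edge set G. *)
Definition graph_prob (R : realType) (bL bR : R) (C : 'M[R]_2) (n : nat)
    (tL tR : {ffun 'I_n -> 'I_2}) (G : bigraph n) : R :=
  (\prod_(i < n) type_prob bL (tL i)) *
  (\prod_(j < n) type_prob bR (tR j)) *
  \prod_(e : 'I_n * 'I_n)
     (if e \in G then edge_prob C n (tL e.1) (tR e.2)
      else 1 - edge_prob C n (tL e.1) (tR e.2)).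

Definition expected_matching (R : realType) (bL bR : R) (C : 'M[R]_2)
    (n : nat) : R :=
  \sum_(tL : {ffun 'I_n -> 'I_2}) \sum_(tR : {ffun 'I_n -> 'I_2})
    \sum_(G : bigraph n) graph_prob bL bR C tL tR G * (max_matching G)%:R.

Definition matching_rate (R : realType) (bL bR : R) (C : 'M[R]_2) : R^nat :=
  fun n => expected_matching bL bR C n / n%:R.

Definition eta (R : realType) (bL bR : R) (C : 'M[R]_2) : R :=
  limn (matching_rate bL bR C).

Definition flex_mx (R : realType) (alpha alphaf : R) : 'M[R]_2 :=
  \matrix_(x < 2, y < 2)
    (nth [::] [:: [:: 2 * alpha; alpha + alphaf];
                  [:: alpha + alphaf; 2 * alphaf]] x)`_y.

Definition eta_TS (R : realType) (B alpha alphaf : R) : R :=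
  eta (B / 2) (B / 2) (flex_mx alpha alphaf).

Definition M1 (R : realType) (B alpha alphaf : R) : R :=
  (2 - B / 2) * alpha + B / 2 * alphaf.

Definition M2 (R : realType) (B alpha alphaf : R) : R :=
  (1 - B / 2) * alpha + (1 + B / 2) * alphaf.

Definition F_TS (R : realType) (B alpha alphaf t1 t2 : R) : R :=
  let m1 := M1 B alpha alphaf in
  let m2 := M2 B alpha alphaf in
  (1 - B / 2) * expR (- (2 * alpha * (1 - B / 2) * expR (- (m1 * t1)))
                      - (alpha + alphaf) * (B / 2) * expR (- (m2 * t2)))
  + B / 2 * expR (- ((alpha + alphaf) * (1 - B / 2) * expR (- (m1 * t1)))
                  - alphaf * B * expR (- (m2 * t2)))
  + (1 - B / 2) * expR (- (m1 * t1)) * (1 + m1 * t1)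
  + B / 2 * expR (- (m2 * t2)) * (1 + m2 * t2)
  - 1.

Definition is_max (R : realType) (A : set R) (m : R) : Prop :=
  A m /\ ubound A m.

(* Main.v *)
Require Import Defs.
From HB Require Import structures.
From mathcomp Require Import all_boot all_order all_algebra zify ring lra.
From mathcomp Require Import all_classical all_reals all_analysis.
From mathcomp Require Import fintype finset.

(** Condition on the types of the right vertices and reveal the left vertices
    ("rows") one at a time. A new row increases the maximum matching iff it meets
    the set D of right vertices missed by some maximum matching, and D only
    shrinks as rows are added. Write G(z) = 1 - F, where z_x is the expected
    number of neighbours in D of a left vertex of type x, so that z_1 = M1 t_1
    and z_2 = M2 t_2.

    Upper bound, for every z >= 0: given D, a row meets D with a probability that
    is concave in the loads of D, hence at most its tangent at z, which is a
    constant plus the probability that a suitable random pendant edge ends in D.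
    Replacing all rows by pendant edges, one by one, leaves a graph whose maximum
    matching is the number of right vertices that are hit, and gives G(z) + o(1).

    Lower bound: since D is monotone, for most numbers k of rows close to n it is
    not changed much by one more row. For such k a second-moment computation shows
    that the left vertices of type x missed by some maximum matching number about
    k a_x exp(-z_x), with z the random load of D. Exposing the edges at one right
    vertex bounds E|D| by the corresponding expression, and the decomposition
    nu >= |complement of D| + |N(D)| yields E[nu] / n >= E[G(z)] - o(1), which is
    at least the minimum of G. *)

Set Implicit Arguments.
Unset Strict Implicit.
Unset Printing Implicit Defensive.

Import Order.TTheory GRing.Theory Num.Theory.
Import numFieldNormedType.Exports.

(** The two bounds meet because [G] is read in two ways. Its term [two_or_more z] is the intercept
    of the tangent to [1 - exp(-s)] at [z] in the upper bound, and the probability of at least two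
    neighbours in D in the lower one. Its other term counts right vertices: those hit by a pendant
    edge, respectively those outside D. The upper bound leaves [z] free and the lower one takes
    whatever random load D has, so the limit of D is never identified, and convergence of the rate
    comes out together with its value.

    The obstacle is that nothing prevents D from changing abruptly near [k = n]. Errors are
    therefore expressed through [loss], the mean shrinkage of D caused by one row: a total shrinkage
    of at most [n], spread over about [d n] sizes, leaves a [k] with [loss] of order [1 / d], while
    giving up [n - k <= d n] rows costs order [d] in the rate. The total error is [O(d)] plus a
    constant depending on [d], divided by [n]. Deviations enter through [|y| <= (A + y^2 / A) / 2],
    so that second moments suffice. *)

Lemma set_ind (T : finType) (P : {set T} -> Prop) : P set0 ->
  (forall x (A : {set T}), x \notin A -> P A -> P (x |: A)) -> forall A, P A.
Proof.
move=> P0 PU A; have [n] := ubnP #|A|; elim: n A => // n IH A lA.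
have [->|[x xA]] := set_0Vmem A; first exact: P0.
rewrite -(setD1K xA); apply: PU; first by rewrite !inE eqxx.
by apply: IH; move: lA; rewrite (cardsD1 x) xA.
Qed.

(** * Matchings as seen from the right side *)

Section RankExtension.
Variable J : finType.
Implicit Types (rho : {set J} -> nat) (s B : {set J}) (v w : J).

Definition gain rho s B : bool := [exists v in s :&: B, rho (B :\ v) == rho B].
(* If [rho B] is the largest size of a matching of the left vertices present so
   far into [B], then [ext rho s B] is that size after a left vertex with
   neighbourhood [s] has been added. *)
Definition ext rho s : {set J} -> nat := fun B => rho B + gain rho s B.

(** Matroid rank functions up to the value at [set0]: increments are 0 or 1, so the second clause
    (what adds nothing to a smaller set adds nothing to a larger one) amounts to submodularity. *)
Definition rank_fun rho : Prop :=
  [/\ forall B v, rho (B :\ v) <= rho B <= (rho (B :\ v)).+1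
    & forall B v w, v != w -> rho (B :\ w :\ v) = rho (B :\ w) ->
        rho (B :\ v) = rho B].

(* The right vertices missed by some maximum matching: a new left vertex enlarges
   the maximum matching iff it has a neighbour among them. *)
Definition avoidable rho : {set J} := [set v | rho (setT :\ v) == rho setT].

Lemma gainP rho s B :
  reflect (exists v, [/\ v \in s, v \in B & rho (B :\ v) = rho B]) (gain rho s B).
Proof.
apply: (iffP existsP) => [[v /andP[]]|[v [vs vB e]]].
  by rewrite inE => /andP[vs vB] /eqP e; exists v.
by exists v; rewrite inE vs vB e eqxx.
Qed.

Lemma gain_mono rho s B w : rank_fun rho -> gain rho s (B :\ w) -> gain rho s B.
Proof.
move=> [_ r2] /gainP[v [vs]]; rewrite !inE => /andP[vw vB] e.
by apply/gainP; exists v; split => //; apply: r2 vw e.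
Qed.

(** [ext rho s] is the rank of the matroid union of [rho] with a matroid of rank at most one
    supported on [s], which is why the class is stable. By induction over the rows, every [rk w A]
    is then a rank function. *)
Lemma ext_rank rho s : rank_fun rho -> rank_fun (ext rho s).
Proof.
move=> rr; have [r1 r2] := rr; split => [B v|B v w vw].
  have /andP[l1 l2] := r1 B v; have gm := @gain_mono rho s B v rr.
  rewrite /ext; case E: (gain rho s (B :\ v)); first by rewrite gm //=; lia.
  case G: (gain rho s B) => /=; last by lia.
  case/gainP: G => v0 [v0s v0B e0].
  have [ev|ne] := eqVneq v0 v; first by rewrite -ev e0; lia.
  have n0 : rho (B :\ v :\ v0) != rho (B :\ v).
    apply/negP => /eqP e1; suff : gain rho s (B :\ v) by rewrite E.
    by apply/gainP; exists v0; rewrite !inE ne v0B.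
  have /andP[_ l3] := r1 (B :\ v) v0.
  have /andP[_ l4] := r1 (B :\ v0) v.
  have /andP[l5 _] := r1 (B :\ v) v0.
  have e3 : B :\ v0 :\ v = B :\ v :\ v0 by rewrite !setDDl setUC.
  by move: l4; rewrite e3; lia.
have e3 u u' : B :\ u :\ u' = B :\ u' :\ u by rewrite !setDDl setUC.
have gm B' x := @gain_mono rho s B' x rr.
have /andP[l1 l2] := r1 (B :\ w) v.
have gm1 := gm (B :\ w) v; have gm2 := gm B v; have gm3 := gm B w.
have gm4 := gm (B :\ v) w.
rewrite /ext => H.
have e1 : rho (B :\ w :\ v) = rho (B :\ w).
  by move: H; case: (gain rho s (B :\ w :\ v)) gm1 => [->|] //=; lia.
have e2 := r2 _ _ _ vw e1.
have g1 : gain rho s (B :\ w :\ v) = gain rho s (B :\ w).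
  by move: H; rewrite e1; do 2 case: gain => //=; lia.
rewrite e2; congr (_ + nat_of_bool _).
apply/idP/idP => [//|/gainP[x [xs xB ex]]].
have [xv|nxv] := eqVneq x v.
  suff : gain rho s (B :\ w :\ v) by rewrite e3.
  rewrite g1; apply/gainP; exists v; split=> //; first by rewrite -xv.
  by rewrite !inE vw -xv.
apply: contraT => /gainP ng.
have h1 : rho (B :\ v :\ x) != rho (B :\ v).
  by apply/eqP=> h; apply: ng; exists x; rewrite !inE nxv.
have ng1 : ~~ gain rho s (B :\ w :\ v).
  by apply/negP; rewrite e3 => /gm4 /gainP.
have ng2 : ~~ gain rho s (B :\ w) by rewrite -g1.
have [xw|nxw] := eqVneq x w.
  by move: h1; rewrite xw e3 e1 e2 -{1}xw ex eqxx.
have h2 : rho (B :\ w :\ x) != rho (B :\ w).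
  apply/eqP=> h; move/negP: ng2; apply; apply/gainP.
  by exists x; rewrite !inE nxw.
have h3 : rho (B :\ w :\ v :\ x) != rho (B :\ w :\ v).
  apply/eqP=> h; move/negP: ng1; apply; apply/gainP.
  by exists x; rewrite !inE nxw nxv.
(* [x] is critical in [B :\ w] and in [B :\ w :\ v], which have equal rank, so both ranks fall by
   one when [x] goes. The second clause at [B :\ x] then contradicts [h1]. *)
have h4 : rho (B :\ x :\ w :\ v) = rho (B :\ x :\ w).
  have -> : B :\ x :\ w :\ v = B :\ w :\ v :\ x.
    by apply/setP=> j; rewrite !inE; do 3 case: eqP.
  have -> : B :\ x :\ w = B :\ w :\ x by rewrite e3.
  have /andP[i1 i2] := r1 (B :\ w :\ v) x.
  have /andP[i3 i4] := r1 (B :\ w) x.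
  by clear -i1 i2 i3 i4 h2 h3 e1; lia.
have := r2 _ _ _ vw h4; rewrite e3 => h5.
by move: h1; rewrite h5 ex e2 eqxx.
Qed.

Lemma gain_avoidable rho s : gain rho s setT = ~~ [disjoint s & avoidable rho].
Proof.
apply/gainP/pred0Pn => [[v [vs _ e]]|[v /= /andP[vs]]].
  by exists v; rewrite /= vs inE e eqxx.
by rewrite inE => /eqP e; exists v.
Qed.

Lemma avoidable_ext rho s : rank_fun rho -> avoidable (ext rho s) \subset avoidable rho.
Proof.
move=> rr; have [r1 _] := rr; apply/subsetP=> v; rewrite !inE /ext => /eqP e.
have := @gain_mono rho s setT v rr; have /andP[l1 l2] := r1 setT v.
by move: e; do 2 case: gain => //=; lia.
Qed.

Lemma avoidable_ext_disjoint rho s : rank_fun rho ->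
  [disjoint s & avoidable rho] -> avoidable (ext rho s) = avoidable rho.
Proof.
move=> rr ds; apply/setP=> v; rewrite !inE /ext.
have := @gain_mono rho s setT v rr; rewrite gain_avoidable ds.
by case: gain => [/(_ isT)//|]; rewrite !addn0.
Qed.

Lemma ext_ge rho s B v : rank_fun rho -> v \in s -> v \in B ->
  rho (B :\ v) < ext rho s B.
Proof.
move=> [r1 _] vs vB; rewrite /ext; have /andP[l1 l2] := r1 B v.
have [e|ne] := eqVneq (rho (B :\ v)) (rho B); last by lia.
have -> : gain rho s B by apply/gainP; exists v.
by lia.
Qed.

Lemma avoidable_ext_eq rho s : rank_fun rho ->
  ~~ [disjoint s & avoidable (ext rho s)] -> avoidable (ext rho s) = avoidable rho.
Proof.
move=> rr; have [r1 r2] := rr; move=> /pred0Pn[v /= /andP[vs vD]].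
apply/eqP; rewrite eqEsubset avoidable_ext //=; apply/subsetP=> w wD.
have vD' := subsetP (avoidable_ext s rr) _ vD.
have gT : gain rho s setT.
  by rewrite gain_avoidable; apply/pred0Pn; exists v; rewrite /= vs.
move: (vD) (vD') (wD); rewrite !inE /ext gT => /eqP hv /eqP hv' /eqP hw.
rewrite hw; apply: contraT => hg.
have {hg}ng : ~~ gain rho s (setT :\ w).
  by apply: contra hg => ->.
have gv : gain rho s (setT :\ v) by move: hv; rewrite hv'; case: gain => //=; lia.
have e3 B u u' : B :\ u :\ u' = B :\ u' :\ u by rewrite !setDDl setUC.
have nvw : v != w by apply: contraNneq ng => <-.
have h1 : rho (setT :\ w :\ v) != rho (setT :\ w).
  by apply: contraNneq ng => h; apply/gainP; exists v; rewrite !inE nvw.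
case/gainP: gv => v' [v's]; rewrite !inE andbT => nv' h2.
have nwv' : v' != w.
  apply/eqP=> ew; move: h1; rewrite e3 hw -hv' -ew => /eqP; apply; exact: h2.
have h3 : rho (setT :\ w :\ v') != rho (setT :\ w).
  by apply: contraNneq ng => h; apply/gainP; exists v'; rewrite !inE nwv'.
have /andP[i1 i2] := r1 (setT :\ w) v.
have /andP[i3 i4] := r1 (setT :\ w) v'.
have /andP[i5 i6] := r1 (setT :\ w :\ v') v.
have /andP[i7 i8] := r1 (setT :\ v :\ v') w.
have e4 : [set: J] :\ v :\ v' :\ w = [set: J] :\ w :\ v' :\ v.
  by apply/setP=> j; rewrite !inE; do 3 case: eqP.
rewrite e4 in i8.
suff : rho (setT :\ w :\ v' :\ v) = rho (setT :\ w :\ v').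
  move=> h; have := r2 _ _ _ _ h; rewrite eq_sym nv' => /(_ isT) h'.
  by move: h1; rewrite h' eqxx.
by clear -i1 i2 i3 i4 i5 i6 i7 i8 h1 h2 h3 hw hv'; lia.
Qed.

(** On [setT :\ v] the sets [s] and [v |: s] offer the same choices, and both gain on [setT]. This
    lets [busy_row] separate the bit at [v] from the rest of the row. *)
Lemma avoidable_ext_setU rho s v : rank_fun rho ->
  ~~ [disjoint s & avoidable rho] ->
  v \in avoidable (ext rho s) -> v \in avoidable (ext rho (v |: s)).
Proof.
move=> rr gs; rewrite !inE /ext => /eqP h.
have g1 : gain rho s setT by rewrite gain_avoidable.
have -> : gain rho (v |: s) setT.
  case/gainP: g1 => w [ws wT e]; apply/gainP; exists w; split => //.
  by rewrite !inE ws orbT.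
have -> : gain rho (v |: s) (setT :\ v) = gain rho s (setT :\ v).
  by apply: eq_existsb => w; rewrite !inE andbT; have [->|] := eqVneq w v; rewrite ?andbF.
by rewrite h g1.
Qed.

Lemma rank_ge_setC rho : rank_fun rho -> #|~: avoidable rho| <= rho setT.
Proof.
move=> rr; have [r1 r2] := rr.
suff H (X : {set J}) : X \subset ~: avoidable rho -> #|X| + rho (~: X) <= rho setT.
  by have := H _ (subxx _); lia.
elim/set_ind: X => [|v X vX IH] XD; first by rewrite cards0 setC0.
have /IH {}IH : X \subset ~: avoidable rho by apply: subset_trans XD; apply: subsetUr.
have vD : v \notin avoidable rho by have := subsetP XD v; rewrite !inE eqxx => /(_ isT).
have -> : ~: (v |: X) = ~: X :\ v by rewrite setCU setIC setDE.
suff ne : rho (~: X :\ v) != rho (~: X).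
  rewrite cardsU1 vX /=; have /andP[] := r1 (~: X) v; lia.
(* Elements outside [avoidable rho] are coloops and stay critical after the deletion of [X]:
   otherwise the second clause puts the elements of [X] back one by one and makes [v] avoidable. *)
apply: contra vD => /eqP e; rewrite inE; apply/eqP.
move: vX e; elim/set_ind: {XD IH} X => [|w X wX IH] vX; first by rewrite setC0.
have -> : ~: (w |: X) = ~: X :\ w by rewrite setCU setIC setDE.
move: vX; rewrite !inE negb_or => /andP[vw vX] e.
by apply: IH => //; apply: r2 vw e.
Qed.

End RankExtension.

(** * Matchings of a bipartite graph as iterated rank extensions *)

Section MatchingRank.
Variables I J : finType.
Implicit Types (w : I -> {set J}) (A : {set I}) (B : {set J}) (M : {set I * J}).

Definition matching_in w A B M : bool :=
  [forall e in M, [&& e.1 \in A, e.2 \in B & e.2 \in w e.1]] &&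
  [forall e in M, forall f in M, ((e.1 == f.1) || (e.2 == f.2)) ==> (e == f)].

Definition rk w A B : nat := \max_(M : {set I * J} | matching_in w A B M) #|M|.

Lemma matching_inP w A B M :
  reflect ((forall e, e \in M -> [/\ e.1 \in A, e.2 \in B & e.2 \in w e.1]) /\
           (forall e f, e \in M -> f \in M -> (e.1 == f.1) || (e.2 == f.2) -> e = f))
    (matching_in w A B M).
Proof.
apply: (iffP andP) => [[/forallP h1 /forallP h2]|[h1 h2]]; split.
- by move=> e eM; have /implyP/(_ eM)/and3P[] := h1 e.
- move=> e f eM fM ef; have /implyP/(_ eM)/forallP/(_ f) := h2 e.
  by move=> /implyP/(_ fM)/implyP/(_ ef)/eqP.
- by apply/forallP=> e; apply/implyP=> eM; apply/and3P; apply: h1.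
- apply/forallP=> e; apply/implyP=> eM; apply/forallP=> f; apply/implyP=> fM.
  by apply/implyP=> ef; apply/eqP; apply: h2.
Qed.

Lemma rk_ge w A B M : matching_in w A B M -> #|M| <= rk w A B.
Proof. by move=> h; rewrite /rk; apply: (leq_bigmax_cond (F := fun M : {set I * J} => #|M|)). Qed.

Lemma rk_witness w A B : exists2 M, matching_in w A B M & #|M| = rk w A B.
Proof.
have h0 : matching_in w A B set0.
  by apply/matching_inP; split=> [e|e f]; rewrite inE.
have [|M hM eM] := @eq_bigmax_cond _ (matching_in w A B) (fun M : {set I * J} => #|M|).
  by apply/card_gt0P; exists set0.
by exists M => //; rewrite -eM.
Qed.

Lemma rk_le w A B k : (forall M, matching_in w A B M -> #|M| <= k) -> rk w A B <= k.
Proof. by move=> h; apply/bigmax_leqP. Qed.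

Lemma rk_eq w w' A B : (forall u, u \in A -> w u :&: B = w' u :&: B) ->
  rk w A B = rk w' A B.
Proof.
move=> h; apply: eq_bigl => M; apply/matching_inP/matching_inP => -[h1 h2].
  split=> // e /h1[eA eB ew]; split=> //.
  by have /setP/(_ e.2) := h _ eA; rewrite !inE eB ew !andbT => <-.
split=> // e /h1[eA eB ew]; split=> //.
by have /setP/(_ e.2) := h _ eA; rewrite !inE eB ew !andbT => ->.
Qed.

Lemma rk_set0 w B : rk w set0 B = 0.
Proof.
apply/eqP; rewrite -leqn0; apply: rk_le => M /matching_inP[h1 _].
rewrite leqn0 cards_eq0; apply/eqP/setP=> e; rewrite inE.
by apply/negP=> /h1[]; rewrite inE.
Qed.

Lemma rk_setD1 w A B v : rk w A (B :\ v) <= rk w A B <= (rk w A (B :\ v)).+1.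
Proof.
apply/andP; split; apply: rk_le => M /matching_inP[h1 h2].
  apply: rk_ge; apply/matching_inP; split=> // e /h1[eA eB ew].
  by split=> //; move: eB; rewrite !inE => /andP[].
have [/existsP[e /andP[eM /eqP ev]]|/existsPn none] := boolP [exists e in M, e.2 == v].
  rewrite (cardsD1 e) eM add1n ltnS; apply: rk_ge; apply/matching_inP; split.
    move=> f; rewrite inE => /andP[]; rewrite inE => fe fM.
    have [fA fB fw] := h1 _ fM; split=> //; rewrite !inE fB andbT.
    apply: contra fe => /eqP fv; apply/eqP; apply: h2 => //.
    by rewrite fv ev eqxx orbT.
  by move=> f g; rewrite !inE => /andP[_ fM] /andP[_ gM]; apply: h2.
apply: leqW; apply: rk_ge; apply/matching_inP; split=> // e eM.
have [eA eB ew] := h1 _ eM; split=> //; rewrite !inE eB andbT.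
by have := none e; rewrite eM.
Qed.

Lemma rk_setU1 w A B u : u \notin A -> rk w (u |: A) B = ext (rk w A) (w u) B.
Proof.
move=> uA; apply/eqP; rewrite eqn_leq; apply/andP; split.
  apply: rk_le => M /matching_inP[h1 h2].
  have [/existsP[e /andP[eM /eqP eu]]|/existsPn none] := boolP [exists e in M, e.1 == u].
    have [_ eB ew] := h1 _ eM; rewrite eu in ew.
    have hM : #|M| <= (rk w A (B :\ e.2)).+1.
      rewrite (cardsD1 e) eM add1n ltnS; apply: rk_ge; apply/matching_inP; split.
        move=> f; rewrite inE => /andP[]; rewrite inE => fe fM.
        have [fA fB fw] := h1 _ fM.
        have n1 : f.1 != u.
          by apply: contra fe => /eqP fu; apply/eqP; apply: h2 => //; rewrite fu eu eqxx.
        have n2 : f.2 != e.2.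
          by apply: contra fe => /eqP fu; apply/eqP; apply: h2 => //; rewrite fu eqxx orbT.
        split=> //; first by move: fA; rewrite !inE (negbTE n1).
        by rewrite !inE fB n2.
      by move=> f g; rewrite !inE => /andP[_ fM] /andP[_ gM]; apply: h2.
    rewrite /ext; have [g|ng] := boolP (gain _ _ _).
      by have /andP[l1 _] := rk_setD1 w A B e.2; lia.
    have /andP[l1 _] := rk_setD1 w A B e.2.
    have ne : rk w A (B :\ e.2) != rk w A B.
      by apply: contraNneq ng => h; apply/gainP; exists e.2.
    by lia.
  rewrite /ext; apply: leq_trans (leq_addr _ _); apply: rk_ge; apply/matching_inP.
  split=> // e eM; have [eA eB ew] := h1 _ eM; split=> //.
  by move: eA (none e); rewrite eM !inE /=; case: eqP.
rewrite /ext; have [/gainP[v [vw vB e]]|ng] := boolP (gain _ _ _); last first.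
  rewrite addn0; apply: rk_le => M /matching_inP[h1 h2]; apply: rk_ge.
  apply/matching_inP; split=> // e eM; have [eA eB ew] := h1 _ eM; split=> //.
  by rewrite inE eA orbT.
have [M /matching_inP[h1 h2] eM] := rk_witness w A (B :\ v).
rewrite -e -eM addn1.
have n1 f : f \in M -> f.1 != u by move=> /h1[fA _ _]; apply: contraNneq uA => <-.
have n2 f : f \in M -> f.2 != v by move=> /h1[_ + _]; rewrite !inE => /andP[].
have nM : (u, v) \notin M by apply/negP => /n1; rewrite eqxx.
have -> : (#|M|).+1 = #|(u, v) |: M| by rewrite cardsU1 nM.
apply: rk_ge; apply/matching_inP; split.
  move=> f; rewrite !inE => /orP[/eqP->|fM] /=; first by rewrite eqxx.
  by have [fA + fw] := h1 _ fM; rewrite !inE fA orbT => /andP[_ ->].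
move=> f g; rewrite !inE => /orP[/eqP->|fM] /orP[/eqP->|gM] //=.
- by rewrite eq_sym (negbTE (n1 _ gM)) eq_sym (negbTE (n2 _ gM)).
- by rewrite (negbTE (n1 _ fM)) (negbTE (n2 _ fM)).
- exact: h2.
Qed.

Lemma rk_rank_fun w A : rank_fun (rk w A).
Proof.
elim/set_ind: A => [|u A uA IH].
  by split=> [B v|B v x _ _]; rewrite !rk_set0.
have [e1 e2] := ext_rank (w u) IH.
split=> [B v|B v x vx]; rewrite !rk_setU1 //.
exact: e2.
Qed.

Lemma rk_setTD1 w u B : rk w setT B = ext (rk w (setT :\ u)) (w u) B.
Proof. by rewrite -rk_setU1 ?setD1K // !inE eqxx. Qed.

(* Half of the Dulmage-Mendelsohn decomposition (equality holds). *)
Lemma rk_ge_cover w :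
  #|~: avoidable (rk w setT)| + #|[set u | ~~ [disjoint w u & avoidable (rk w setT)]]|
    <= rk w setT setT.
Proof.
set D := avoidable _; set N := [set u | _].
(* The rows of [N] are taken out one at a time: each meets D, so the rank drops by exactly one and,
   by [avoidable_ext_eq], D stays the same. What remains is bounded below by [rank_ge_setC]. *)
suff H (W : {set I}) : W \subset N ->
    rk w setT setT = rk w (~: W) setT + #|W| /\ avoidable (rk w (~: W)) = D.
  have [-> <-] := H _ (subxx _).
  by rewrite leq_add2r; apply: rank_ge_setC; apply: rk_rank_fun.
elim/set_ind: W => [|u W uW IH] WN; first by rewrite cards0 setC0 addn0.
have /IH {IH} [-> eD] : W \subset N by apply: subset_trans WN; apply: subsetUr.
have uN : ~~ [disjoint w u & D] by have := subsetP WN u; rewrite !inE eqxx => /(_ isT).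
have eW : ~: W = u |: ~: (u |: W).
  by apply/setP=> x; rewrite !inE; case: eqP => [->|].
have un : u \notin ~: (u |: W) by rewrite !inE eqxx.
have rr := rk_rank_fun w (~: (u |: W)).
have eA : avoidable (rk w (~: W)) = avoidable (ext (rk w (~: (u |: W))) (w u)).
  by apply/setP=> v; rewrite !inE eW !rk_setU1.
have eD' : avoidable (ext (rk w (~: (u |: W))) (w u)) = avoidable (rk w (~: (u |: W))).
  by apply: avoidable_ext_eq; rewrite // -eA eD.
split; last by rewrite -eD' -eA.
rewrite {1}eW rk_setU1 // /ext gain_avoidable -eD' -eA eD uN cardsU1 uW /=.
by rewrite -addnA.
Qed.

Lemma rk_hit w : rk w setT setT <= \sum_v [exists u, v \in w u].
Proof.
apply: rk_le => M /matching_inP[h1 h2].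
have inj : {in M &, injective (fun e : I * J => e.2)}.
  by move=> e f eM fM /= h; apply: h2 => //; rewrite h eqxx orbT.
rewrite -(card_in_imset inj) -sum1_card big_mkcond /=; apply: leq_sum => v _.
case: imsetP => [[e eM ->]|//].
have -> : [exists u, e.2 \in w u] by apply/existsP; exists e.1; have [] := h1 _ eM.
by [].
Qed.

(** If the two ranks agreed, some maximum matching of the whole graph would avoid both [u] and [v],
    and the edge between them would enlarge it. *)
Lemma avoidable_not_adj w v u : v \in avoidable (rk w setT) -> v \in w u ->
  rk w setT (setT :\ v) != rk w (setT :\ u) (setT :\ v).
Proof.
rewrite inE => /eqP-> vu; rewrite (rk_setTD1 w u setT).
by rewrite gtn_eqF // ext_ge //; apply: rk_rank_fun.
Qed.

Lemma disjoint_setD1 w v u : [disjoint w u & avoidable (rk w (setT :\ u))] ->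
  rk w setT (setT :\ v) = rk w (setT :\ u) (setT :\ v).
Proof.
move=> d; rewrite (rk_setTD1 w u) /ext.
have := @gain_mono _ (rk w (setT :\ u)) (w u) setT v (rk_rank_fun _ _).
by rewrite gain_avoidable d; case: gain => [/(_ isT)//|]; rewrite addn0.
Qed.

End MatchingRank.

Local Open Scope ring_scope.
(** * Finite product measures *)

Section ProductExpectation.
Variables (R : realType) (I T : finType).
Implicit Types (m : I -> T -> R) (f g : {ffun I -> T} -> R) (w : {ffun I -> T}).

Definition pE m f : R := \sum_(w : {ffun I -> T}) (\prod_i m i (w i)) * f w.

Definition is_law (p : T -> R) : Prop := (forall s, 0 <= p s) /\ \sum_s p s = 1.

Definition upd w (u : I) (s : T) : {ffun I -> T} := [ffun i => if i == u then s else w i].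

Lemma upd_same w u s : upd w u s u = s.
Proof. by rewrite ffunE eqxx. Qed.

Lemma upd_other w u s i : i != u -> upd w u s i = w i.
Proof. by rewrite ffunE => /negbTE->. Qed.

Lemma upd_upd w u s s' : upd (upd w u s) u s' = upd w u s'.
Proof. by apply/ffunP=> i; rewrite !ffunE; case: eqP. Qed.

Lemma upd_id w u : upd w u (w u) = w.
Proof. by apply/ffunP=> i; rewrite !ffunE; case: eqP => // ->. Qed.

Lemma eq_pE m f g : f =1 g -> pE m f = pE m g.
Proof. by move=> fg; apply: eq_bigr => w _; rewrite fg. Qed.

Lemma pE_prod m (g : I -> T -> R) :
  pE m (fun w => \prod_i g i (w i)) = \prod_i \sum_s m i s * g i s.
Proof.
rewrite bigA_distr_bigA; apply: eq_bigr => w _.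
by rewrite -big_split.
Qed.

Lemma pE_cst m (x : R) : (forall i, \sum_s m i s = 1) -> pE m (fun=> x) = x.
Proof.
move=> m1; rewrite /pE -big_distrl /= -[RHS]mul1r; congr (_ * _).
by rewrite -bigA_distr_bigA big1.
Qed.

Lemma pED m f g : pE m (fun w => f w + g w) = pE m f + pE m g.
Proof. by rewrite /pE -big_split; apply: eq_bigr => w _; rewrite mulrDr. Qed.

Lemma pEZ m (x : R) f : pE m (fun w => x * f w) = x * pE m f.
Proof. by rewrite /pE big_distrr; apply: eq_bigr => w _; rewrite mulrCA. Qed.

Lemma pEN m f : pE m (fun w => - f w) = - pE m f.
Proof. by rewrite -mulN1r -pEZ; apply: eq_pE => w; rewrite mulN1r. Qed.

Lemma pEB m f g : pE m (fun w => f w - g w) = pE m f - pE m g.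
Proof. by rewrite pED pEN. Qed.

Lemma pE_sum (K : finType) (P : pred K) m (f : K -> {ffun I -> T} -> R) :
  pE m (fun w => \sum_(k | P k) f k w) = \sum_(k | P k) pE m (f k).
Proof. by rewrite /pE exchange_big; apply: eq_bigr => w _; rewrite big_distrr. Qed.

Lemma ler_pE m f g : (forall i s, 0 <= m i s) -> (forall w, f w <= g w) ->
  pE m f <= pE m g.
Proof.
by move=> m0 fg; apply: ler_sum => w _; apply: ler_wpM2l; rewrite ?prodr_ge0.
Qed.

(** Integrates out coordinate [u] alone. The value drawn from [m' u] is overwritten, so only its
    total mass matters; [row_replacement] uses this freedom to compare two laws at [u] over one
    measure. *)
Lemma pE_resample m m' u f : (forall i, i != u -> m i = m' i) ->
  \sum_s m' u s = 1 ->
  pE m f = pE m' (fun w => \sum_s m u s * f (upd w u s)).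
Proof.
move=> mm' m1; rewrite /pE.
under [RHS]eq_bigr => w _ do rewrite big_distrr /=.
rewrite pair_big /=.
(* Exchanges the value at [u] with the fresh one. *)
pose h (p : {ffun I -> T} * T) := (upd p.1 u p.2, p.1 u).
have hK : involutive h.
  by move=> [w s]; rewrite /h /= upd_upd upd_same upd_id.
rewrite (reindex_inj (inv_inj hK)) /= -(pair_big xpredT xpredT
  (fun w s => (\prod_i m' i ((upd w u s) i)) *
     (m u (w u) * f (upd (upd w u s) u (w u))))) /=.
apply: eq_bigr => w _.
rewrite -[LHS]mul1r -{1}m1 big_distrl; apply: eq_bigr => s _ /=.
rewrite upd_upd upd_id (bigD1 u) //= [in RHS](bigD1 u) //= upd_same.
have -> : \prod_(i | i != u) m' i ((upd w u s) i) = \prod_(i | i != u) m i (w i).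
  by apply: eq_bigr => i iu; rewrite upd_other // mm'.
by rewrite -!mulrA; congr (_ * _); rewrite mulrCA.
Qed.

Lemma pE_resample1 (p : T -> R) u f : \sum_s p s = 1 ->
  pE (fun=> p) f = pE (fun=> p) (fun w => \sum_s p s * f (upd w u s)).
Proof. by move=> p1; apply: pE_resample. Qed.

Lemma pE_ge0 m f : (forall i s, 0 <= m i s) -> (forall w, 0 <= f w) -> 0 <= pE m f.
Proof. by move=> m0 f0; apply: sumr_ge0 => w _; rewrite mulr_ge0 ?prodr_ge0. Qed.

Lemma pE_coord (p : T -> R) u (g : T -> R) : is_law p ->
  pE (fun=> p) (fun w => g (w u)) = \sum_s p s * g s.
Proof.
move=> [_ p1]; rewrite (pE_resample1 u) //.
transitivity (pE (fun=> p) (fun=> \sum_s p s * g s)).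
  by apply: eq_pE => w; apply: eq_bigr => s _; rewrite upd_same.
by rewrite pE_cst.
Qed.

End ProductExpectation.

(** * Random subsets with independent elements *)

Section BernoulliSet.
Variables (R : realType) (J : finType).
Implicit Types (q : J -> R) (S X : {set J}) (h : {set J} -> R).

Definition ber q S : R := \prod_j (if j \in S then q j else 1 - q j).

Lemma ber_ge0 q S : (forall j, 0 <= q j <= 1) -> 0 <= ber q S.
Proof.
move=> q01; apply: prodr_ge0 => j _; have /andP[q0 q1] := q01 j.
by case: ifP; rewrite ?subr_ge0.
Qed.

Lemma ber_disjoint q X :
  \sum_S ber q S * [disjoint S & X]%:R = \prod_(v in X) (1 - q v).
Proof.
rewrite [RHS]big_mkcond /=.
transitivity (\prod_j ((if j \in X then 0 else q j) + (1 - q j))); last first.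
  by apply: eq_bigr => j _; case: ifP => _; rewrite ?add0r // addrC subrK.
rewrite bigA_distr; apply: eq_bigr => S _.
have [dSX|] := boolP [disjoint S & X].
  rewrite mulr1; apply: eq_bigr => j _; case: ifP => // jS.
  by rewrite (disjointFr dSX jS).
move=> /pred0Pn[j /= /andP[jS jX]]; rewrite mulr0 (bigD1 j) //= jS jX mul0r.
by [].
Qed.

Lemma ber_sum q : \sum_S ber q S = 1.
Proof.
have := ber_disjoint q set0; rewrite big_set0 => <-.
by apply: eq_bigr => S _; rewrite disjoint_sym disjoints_subset sub0set mulr1.
Qed.

(** Independence of the bit at [v] from the rest of the set; the hypothesis says that [h] ignores
    this bit. *)
Lemma ber_in q v h : (forall S, h (S :\ v) = h S) ->
  \sum_S ber q S * ((v \in S)%:R * h S) = q v * \sum_S ber q S * h S.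
Proof.
move=> hv; pose B S := \prod_(j | j != v) (if j \in S then q j else 1 - q j).
have BE S : ber q S = (if v \in S then q v else 1 - q v) * B S.
  by rewrite /ber (bigD1 v).
have Bv S : B (S :\ v) = B S.
  by apply: eq_bigr => j jv; rewrite !inE jv.
have e S : ber q S * ((v \in S)%:R * h S) = if v \in S then q v * (B S * h S) else 0.
  by rewrite BE; case: ifP => _ /=; rewrite ?mul1r ?mul0r ?mulr0 -?mulrA.
under eq_bigr => S _ do rewrite e.
rewrite -big_mkcond /= -big_distrr /=; congr (_ * _).
rewrite [RHS](bigID (fun S : {set J} => v \in S)) /=.
have e1 : \sum_(S : {set J} | v \notin S) ber q S * h S =
    (1 - q v) * \sum_(S : {set J} | v \in S) B S * h S.
  rewrite (reindex_onto (fun S : {set J} => S :\ v) (fun S => v |: S)) /=; last first.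
    by move=> S vS; rewrite setU1K.
  rewrite big_distrr /=; apply: eq_big => [S|S].
    rewrite !inE eqxx /=; apply/eqP/idP => [<-|vS]; first by rewrite !inE eqxx.
    by rewrite setD1K.
  by rewrite !inE eqxx /= => _; rewrite BE !inE eqxx /= Bv hv mulrA.
have e2 : \sum_(S : {set J} | v \in S) ber q S * h S =
    q v * \sum_(S : {set J} | v \in S) B S * h S.
  by rewrite big_distrr; apply: eq_bigr => S vS; rewrite BE vS -?mulrA.
by rewrite e1 e2 -mulrDl addrC subrK mul1r.
Qed.

Lemma ber_notin q v h : (forall S, h (S :\ v) = h S) ->
  \sum_S ber q S * ((v \notin S)%:R * h S) = (1 - q v) * \sum_S ber q S * h S.
Proof.
move=> hv; rewrite mulrBl mul1r -(ber_in q hv) -sumrB; apply: eq_bigr => S _.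
by case: (v \in S); rewrite ?mul1r ?mul0r ?mulr0 ?subrr ?subr0.
Qed.

End BernoulliSet.

(** * Elementary estimates for the exponential *)

Section Exponentials.
Variable R : realType.
Implicit Types x y z q : R.

Lemma expRN_le q : 0 <= q -> expR (- q) <= 1 - q + q ^+ 2.
Proof.
move=> q0; have q1 : 0 < 1 + q by lra.
have h1 : expR (- q) <= (1 + q)^-1.
  by rewrite expRN lef_pV2 ?posrE ?expR_gt0 // expR_ge1Dx.
apply: le_trans h1 _; rewrite -[X in X <= _]mul1r ler_pdivrMr //.
have : 0 <= q ^+ 3 by rewrite exprn_ge0.
have -> : (1 - q + q ^+ 2) * (1 + q) = 1 + q ^+ 3 by ring.
by lra.
Qed.

Lemma prod_le_expR (K : Type) (r : seq K) (q : K -> R) : (forall v, 0 <= q v <= 1) ->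
  \prod_(v <- r) (1 - q v) <= expR (- \sum_(v <- r) q v).
Proof.
move=> q01; rewrite -sumrN expR_sum; apply: ler_prod => v _.
by have /andP[q0 q1] := q01 v; rewrite subr_ge0 q1 expR_ge1Dx.
Qed.

(** Each factor differs from [expR (- q v)] by at most [q v ^+ 2] ([expRN_le]), and all partial
    products are at most 1, so the differences add up. *)
Lemma prod_ge_expR (K : Type) (r : seq K) (q : K -> R) : (forall v, 0 <= q v <= 1) ->
  expR (- \sum_(v <- r) q v) - \sum_(v <- r) q v ^+ 2 <= \prod_(v <- r) (1 - q v).
Proof.
move=> q01; elim: r => [|v r IH]; first by rewrite !big_nil oppr0 expR0 addr0.
rewrite !big_cons; have /andP[q0 q1] := q01 v.
set P := \prod_(j <- r) _ in IH *; set s := \sum_(j <- r) q j in IH *.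
set s2 := \sum_(j <- r) _ in IH *.
have P0 : 0 <= P by apply: prodr_ge0 => j _; have /andP[_] := q01 j; rewrite subr_ge0.
have P1 : P <= 1.
  apply: le_trans (prod_le_expR r q01) _; rewrite -expR0 ler_expR oppr_le0.
  by apply: sumr_ge0 => j _; have /andP[] := q01 j.
have s20 : 0 <= s2 by apply: sumr_ge0 => j _; rewrite sqr_ge0.
have h1 := expRN_le q0.
have h2 : expR (- q v) <= 1 by rewrite -expR0 ler_expR oppr_le0.
have h3 := expR_gt0 (- q v).
rewrite opprD expRD.
have h4 : expR (- q v) * (expR (- s) - s2) <= expR (- q v) * P.
  by rewrite ler_wpM2l // ltW.
have h5 : 0 <= (1 - expR (- q v)) * s2 by rewrite mulr_ge0 // subr_ge0.
have h6 : 0 <= (1 - q v + q v ^+ 2 - expR (- q v)) * P.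
  by rewrite mulr_ge0 // subr_ge0.
have h7 : 0 <= q v ^+ 2 * (1 - P) by rewrite mulr_ge0 ?sqr_ge0 // subr_ge0.
by nra.
Qed.

Lemma expRN_tangent z x : expR (- z) * (1 + z - x) <= expR (- x).
Proof.
rewrite -[X in _ <= expR X](_ : - z + (z - x) = - x); last by ring.
by rewrite expRD ler_wpM2l ?expR_ge0 // -addrA expR_ge1Dx.
Qed.

Lemma expRN_lip x y : 0 <= x -> 0 <= y -> expR (- x) <= expR (- y) + `|x - y|.
Proof.
move=> x0 y0; have h := expRN_tangent x y.
have h1 : expR (- x) <= 1 by rewrite -expR0 ler_expR oppr_le0.
have h0 := expR_gt0 (- x).
have [h2|h2] := lerP 0 (x - y).
  by rewrite ger0_norm //; nra.
rewrite ltr0_norm //.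
have : expR (- x) <= expR (- y) + (y - x); last by lra.
by nra.
Qed.

(** Concavity of [1 - exp(-y)] and its value 0 at 0. It turns a bound for [n] rows into one for
    [k = l n] rows at the price of a factor [l]. *)
Lemma one_sub_expRN_scale x y : 0 <= x <= 1 -> 0 <= y ->
  x * (1 - expR (- y)) <= 1 - expR (- (x * y)).
Proof.
move=> /andP[x0 x1] y0.
have h1 := expRN_tangent (x * y) y.
have h2 : expR (- (x * y)) * (1 + x * y) <= 1.
  by have := expRN_tangent (x * y) 0; rewrite oppr0 expR0 addr0.
have h3 : x * (expR (- (x * y)) * (1 + x * y - y)) <= x * expR (- y).
  by rewrite ler_wpM2l.
have h4 : (1 - x) * (expR (- (x * y)) * (1 + x * y)) <= (1 - x) * 1.
  by rewrite ler_wpM2l // subr_ge0.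
by nra.
Qed.

(* The probability that a Poisson variable of mean [z] is at least 2. *)
Definition two_or_more z : R := 1 - expR (- z) * (1 + z).

Lemma two_or_more_mono x y : 0 <= x -> x <= y -> two_or_more x <= two_or_more y.
Proof.
move=> x0 xy; rewrite /two_or_more lerD2l lerN2.
have -> : - y = - x + (x - y) by ring.
rewrite expRD -mulrA ler_wpM2l ?expR_ge0 //.
have h : expR (x - y) * (1 + (y - x)) <= 1.
  have -> : x - y = - (y - x) by ring.
  rewrite expRN mulrC ler_pdivrMr ?expR_gt0 // mul1r expR_ge1Dx //.
have h1 : expR (x - y) <= 1 by rewrite -expR0 ler_expR subr_le0.
have h2 := expR_gt0 (x - y).
by nra.
Qed.

End Exponentials.

(** * Rank of independent random rows *)

Section Chain.
Variables (R : realType) (X J : finType) (x0 : X).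
Local Notation row := (X * {set J})%type.
Implicit Types (p : row -> R) (F G : ({set J} -> nat) -> R) (rho : {set J} -> nat).

Definition nb (I : finType) (w : {ffun I -> row}) (i : I) : {set J} := (w i).2.

Definition stepE p F rho : R := \sum_s p s * F (ext rho s.2).

(* The expectation of [F] at the rank function of [k] independent rows of law [p]
   (see [pE_chain]). *)
Definition chain p k F : R := iter k (stepE p) F (fun=> 0%N).

Definition rankF : ({set J} -> nat) -> R := fun rho => (rho setT)%:R.

Lemma rk_upd (I : finType) (w : {ffun I -> row}) u s (A : {set I}) : u \notin A ->
  rk (nb (upd w u s)) A = rk (nb w) A.
Proof.
move=> uA; apply: funext => B; apply: rk_eq => i iA.
by rewrite /nb upd_other //; apply: contraNneq uA => <-.
Qed.

Lemma rk_upd_setU1 (I : finType) (w : {ffun I -> row}) u s (A : {set I}) : u \notin A ->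
  rk (nb (upd w u s)) (u |: A) = ext (rk (nb w) A) s.2.
Proof.
move=> uA; apply: funext => B; rewrite rk_setU1 // rk_upd //.
by rewrite /nb upd_same.
Qed.

Lemma rk_upd_setT (I : finType) (w : {ffun I -> row}) u s :
  rk (nb (upd w u s)) setT = ext (rk (nb w) (setT :\ u)) s.2.
Proof. by rewrite -(@rk_upd_setU1 _ w u) ?setD1K // !inE eqxx. Qed.

Lemma pE_chain (I : finType) p (A : {set I}) F : is_law p ->
  pE (fun _ : I => p) (fun w => F (rk (nb w) A)) = chain p #|A| F.
Proof.
move=> lp; have p1 := lp.2; elim/set_ind: A F => [|u A uA IH] F.
  rewrite cards0 /chain /= -[RHS](@pE_cst R I row (fun=> p)) //.
  by apply: eq_pE => w; congr F; apply: funext => B; rewrite rk_set0.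
rewrite (pE_resample1 u) //.
have -> : chain p #|u |: A| F = chain p #|A| (stepE p F).
  by rewrite cardsU1 uA /chain iterSr.
rewrite -IH; apply: eq_pE => w.
by apply: eq_bigr => s _; rewrite rk_upd_setU1.
Qed.

Lemma chain_le p k F G : is_law p -> (forall rho, F rho <= G rho) ->
  chain p k F <= chain p k G.
Proof.
move=> [p0 _] FG; rewrite /chain; elim: k (fun=> 0%N) => //= k IH rho.
by apply: ler_sum => s _; apply: ler_wpM2l.
Qed.

Lemma iter_stepE_lin p k x y F G rho :
  iter k (stepE p) (fun r => x * F r + y * G r) rho =
  x * iter k (stepE p) F rho + y * iter k (stepE p) G rho.
Proof.
elim: k rho => //= k IH rho; rewrite /stepE !big_distrr -big_split.
by apply: eq_bigr => s _ /=; rewrite IH mulrDr !(mulrCA (p s)).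
Qed.

Lemma iter_stepE_cst p k x rho : is_law p -> iter k (stepE p) (fun=> x) rho = x.
Proof.
move=> [_ p1]; elim: k rho => //= k IH rho; rewrite /stepE.
by under eq_bigr => s _ do rewrite IH; rewrite -big_distrl /= p1 mul1r.
Qed.

Lemma stepE_rankF p rho : is_law p ->
  stepE p rankF rho = rankF rho + \sum_s p s * (~~ [disjoint s.2 & avoidable rho])%:R.
Proof.
move=> [_ p1]; have E : rankF rho = \sum_s p s * rankF rho.
  by rewrite -big_distrl /= p1 mul1r.
rewrite {1}E -big_split /stepE; apply: eq_bigr => s _.
by rewrite /= -mulrDr /rankF /ext gain_avoidable natrD.
Qed.

Lemma chain_rankS p k : is_law p ->
  chain p k rankF <= chain p k.+1 rankF <= chain p k rankF + 1.
Proof.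
move=> lp; have [p0 p1] := lp; rewrite [chain p k.+1 _]/chain iterSr.
have g0 rho : 0 <= \sum_s p s * (~~ [disjoint s.2 & avoidable rho])%:R.
  by apply: sumr_ge0 => s _; rewrite mulr_ge0.
have g1 rho : \sum_s p s * (~~ [disjoint s.2 & avoidable rho])%:R <= 1.
  rewrite -[leRHS]p1; apply: ler_sum => s _.
  by rewrite ler_piMr // lern1 leq_b1.
apply/andP; split; first by apply: chain_le => // rho; rewrite stepE_rankF // lerDl.
have -> : chain p k rankF + 1 = chain p k (fun rho => 1 * rankF rho + 1 * 1).
  by rewrite /chain iter_stepE_lin !mul1r iter_stepE_cst.
by apply: chain_le => // rho; rewrite stepE_rankF // !mul1r lerD2l.
Qed.

Lemma chain_rank_mono p j k : is_law p -> (j <= k)%N ->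
  chain p j rankF <= chain p k rankF.
Proof.
move=> lp /subnK<-; elim: (k - j)%N => // d IH; rewrite addSn.
by have /andP[h _] := chain_rankS (d + j) lp; apply: le_trans h.
Qed.

Lemma chain_rank_lip p j k : is_law p ->
  chain p k rankF - chain p j rankF <= `|k%:R - j%:R|.
Proof.
move=> lp; have [jk|/ltnW kj] := leqP j k; last first.
  by apply: le_trans (normr_ge0 _); rewrite subr_le0 chain_rank_mono.
rewrite -natrB // normr_nat -{1}(subnK jk); elim: (k - j)%N => [|d IH].
  by rewrite subrr.
have /andP[_ h] := chain_rankS (d + j) lp; rewrite addSn -natr1.
by lra.
Qed.

(* Keeping each row only with a small probability [d] makes the weights of
   [pendant] sum to at most 1. *)
Definition lazy (d : R) p : row -> R :=
  fun s => d * p s + (1 - d) * (s == (x0, set0))%:R.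

Lemma sum_point (T : finType) (y : T) (f : T -> R) :
  \sum_s (s == y)%:R * f s = f y.
Proof.
rewrite (bigD1 y) //= eqxx mul1r big1 ?addr0 // => s /negbTE->.
by rewrite mul0r.
Qed.

Lemma sum_lazy d p (f : row -> R) :
  \sum_s lazy d p s * f s = d * (\sum_s p s * f s) + (1 - d) * f (x0, set0).
Proof.
rewrite -[f (x0, set0)](sum_point (x0, set0)) !big_distrr -big_split.
by apply: eq_bigr => s _ /=; rewrite /lazy mulrDl !mulrA.
Qed.

Lemma lazy_law d p : 0 <= d <= 1 -> is_law p -> is_law (lazy d p).
Proof.
move=> /andP[d0 d1] [p0 p1]; split=> [s|].
  by rewrite addr_ge0 ?mulr_ge0 ?subr_ge0.
under eq_bigr => s _ do rewrite -[lazy _ _ _]mulr1.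
rewrite sum_lazy mulr1; under eq_bigr => s _ do rewrite mulr1.
by rewrite p1 mulr1 addrC subrK.
Qed.

Lemma ext_set0 rho : ext rho set0 = rho.
Proof.
apply: funext => B; rewrite /ext; case: gainP => [[v []]|]; first by rewrite inE.
by rewrite addn0.
Qed.

(* The number of active rows after [l] lazy steps is binomial with mean [l d];
   the error is its variance about [n - j], through [|x| <= (A + x^2 / A) / 2]. *)
Lemma chain_lazy d p n l j A : is_law p -> 0 <= d <= 1 -> 0 < A ->
  chain p n rankF -
    (A + ((n%:R - j%:R - l%:R * d) ^+ 2 + l%:R * d * (1 - d)) / A) / 2
  <= chain (lazy d p) l (iter j (stepE p) rankF).
Proof.
move=> lp /andP[d0 d1] A0; elim: l j => [|l IH] j.
  rewrite !mul0r subr0 addr0; have h := chain_rank_lip j n lp.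
  rewrite {2}/chain /= -/(chain p j rankF).
  set x := n%:R - j%:R in h *.
  have : `|x| <= (A + x ^+ 2 / A) / 2.
    have e : (A + x ^+ 2 / A) / 2 - `|x| = (A - `|x|) ^+ 2 / (2 * A).
      rewrite -(real_normK (num_real x)); set y := `|x|; field.
      by rewrite gt_eqF.
    by rewrite -subr_ge0 e divr_ge0 ?sqr_ge0 // mulr_ge0 // ltW.
  by lra.
rewrite /chain iterSr.
have -> : stepE (lazy d p) (iter j (stepE p) rankF) =
    (fun r => d * iter j.+1 (stepE p) rankF r + (1 - d) * iter j (stepE p) rankF r).
  by apply: funext => r; rewrite {1}/stepE sum_lazy /= ext_set0.
rewrite iter_stepE_lin.
have h1 := IH j.+1; have h2 := IH j.
rewrite -/(chain _ _ _) -[iter _ _ _ _ in X in _ <= _ + X]/(chain _ _ _) in h1 h2 *.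
set u := chain (lazy d p) l _ in h1 *; set v := chain (lazy d p) l _ in h2 *.
have h3 : d * (chain p n rankF -
    (A + ((n%:R - j.+1%:R - l%:R * d) ^+ 2 + l%:R * d * (1 - d)) / A) / 2) <= d * u.
  by rewrite ler_wpM2l.
have h4 : (1 - d) * (chain p n rankF -
    (A + ((n%:R - j%:R - l%:R * d) ^+ 2 + l%:R * d * (1 - d)) / A) / 2) <= (1 - d) * v.
  by rewrite ler_wpM2l // subr_ge0.
(* The identity [d (x - 1)^2 + (1 - d) x^2 = (x - d)^2 + d (1 - d)] makes the recursion for the
   error exact. *)
apply: le_trans (lerD h3 h4); rewrite le_eqVlt; apply/orP; left; apply/eqP.
rewrite -!natr1; field.
by rewrite gt_eqF.
Qed.

(** Hybrid argument: rows are switched from [p] to [p'] one at a time. The increment due to row [u]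
    is decided by the avoidable set of the other rows, which is independent of row [u], so the
    hypothesis applies with that set as [Y]. *)
Lemma row_replacement (I : finType) p p' (c : R) : is_law p -> is_law p' ->
  (forall Y : {set J}, \sum_s p s * (~~ [disjoint s.2 & Y])%:R <=
             c + \sum_s p' s * (~~ [disjoint s.2 & Y])%:R) ->
  chain p #|I| rankF <= #|I|%:R * c + chain p' #|I| rankF.
Proof.
move=> lp lp' H; rewrite -cardsT -!(@pE_chain I _ setT) //.
pose m (W : {set I}) i := if i \in W then p' else p.
pose f (w : {ffun I -> row}) := rankF (rk (nb w) setT).
suff S (W : {set I}) : pE (m set0) f <= #|W|%:R * c + pE (m W) f.
  have e0 : m set0 = (fun=> p) by apply: funext => i; rewrite /m inE.
  have eT : m setT = (fun=> p') by apply: funext => i; rewrite /m inE.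
  by have := S setT; rewrite e0 eT.
elim/set_ind: W => [|u W uW IH]; first by rewrite cards0 mul0r add0r.
apply: le_trans IH _; rewrite cardsU1 uW natrD mulrDl mul1r -addrA [X in _ <= X]addrCA lerD2l.
have lm i : is_law (m (u |: W) i) by rewrite /m; case: ifP.
rewrite (@pE_resample _ _ _ (m W) (m (u |: W)) u); last 2 first.
- by move=> i iu; rewrite /m !inE (negbTE iu).
- by rewrite /m !inE eqxx; apply: lp'.2.
rewrite [X in _ <= _ + X](@pE_resample _ _ _ (m (u |: W)) (m (u |: W)) u) //; last first.
  by rewrite /m !inE eqxx; apply: lp'.2.
rewrite -[X in _ <= X + _](@pE_cst R I row (m (u |: W))); last by move=> i; apply: (lm i).2.
rewrite -pED; apply: ler_pE => [i s|w]; first exact: (lm i).1.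
have E q : is_law q -> \sum_s q s * f (upd w u s) = rankF (rk (nb w) (setT :\ u)) +
    \sum_s q s * (~~ [disjoint s.2 & avoidable (rk (nb w) (setT :\ u))])%:R.
  move=> lq; rewrite -stepE_rankF //; apply: eq_bigr => s _.
  by rewrite /f rk_upd_setT.
rewrite {1 2}/m !inE eqxx (negbTE uW) /= !E // [X in _ <= X]addrCA lerD2l.
exact: H.
Qed.

Lemma chain_rank_hit (I : finType) p : is_law p ->
  chain p #|I| rankF <= \sum_v (1 - (\sum_s p s * (v \notin s.2)%:R) ^+ #|I|).
Proof.
move=> lp; rewrite -cardsT -(@pE_chain I _ setT) //.
apply: (@le_trans _ _ (pE (fun _ : I => p)
    (fun w => \sum_v (1 - \prod_i (v \notin (w i).2)%:R)))).
  apply: ler_pE => [_|w]; first exact: lp.1.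
  rewrite /rankF; apply: le_trans (_ : (\sum_v [exists u, v \in nb w u])%:R <= _).
    by rewrite ler_nat rk_hit.
  rewrite natr_sum; apply: ler_sum => v _.
  case: existsP => [[u vu]|ne].
    by rewrite (bigD1 u) //= -/(nb w u) vu mul0r subr0.
  rewrite big1 ?subrr // => u _; case vu: (v \in (w u).2) => //.
  by case: ne; exists u.
rewrite pE_sum; apply: ler_sum => v _; rewrite pEB pE_cst; last by move=> _; apply: lp.2.
rewrite (pE_prod (fun _ : I => p) (fun _ s => (v \notin s.2)%:R)).
by rewrite prodr_const cardsT.
Qed.

End Chain.

(** * Upper bound: trading rows for pendant edges *)

Section RowLaw.
Variables (R : realType) (X J : finType) (x0 : X).
Variables (a : X -> R) (q : X -> J -> R).
Hypothesis a_law : is_law a.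
Hypothesis q01 : forall x v, 0 <= q x v <= 1.
Local Notation row := (X * {set J})%type.

Definition row_law (s : row) : R := a s.1 * ber (q s.1) s.2.

Lemma sum_row (f : row -> R) :
  \sum_s row_law s * f s = \sum_x a x * \sum_S ber (q x) S * f (x, S).
Proof.
rewrite [RHS](eq_bigr (fun x => \sum_S row_law (x, S) * f (x, S))).
  by rewrite pair_bigA; apply: eq_bigr => -[].
by move=> x _; rewrite big_distrr; apply: eq_bigr => S _; rewrite /row_law /= mulrA.
Qed.

Lemma row_law_law : is_law row_law.
Proof.
split=> [s|]; first by rewrite mulr_ge0 ?ber_ge0 // a_law.1.
under eq_bigr => s _ do rewrite -[row_law s]mulr1.
rewrite sum_row -[RHS]a_law.2; apply: eq_bigr => x _.
under eq_bigr => S _ do rewrite mulr1.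
by rewrite ber_sum mulr1.
Qed.

Variable z : X -> R.

(** Slope and, in [tilt_cst], intercept of the tangent bound [1 - exp(-s) <= two_or_more z + exp(-z)
    * s], averaged over the type of a row. *)
Definition tilt v : R := \sum_x a x * (expR (- z x) * q x v).
Definition tilt_cst : R := \sum_x a x * two_or_more (z x).

Lemma tilt_ge0 v : 0 <= tilt v.
Proof.
apply: sumr_ge0 => x _; rewrite mulr_ge0 ?a_law.1 // mulr_ge0 ?expR_ge0 //.
by have /andP[] := q01 x v.
Qed.

(* [exp(-z)] lies above its tangents, so on every set [Y] the hitting probability
   of a row is at most an affine function of [Y]. *)
Lemma row_hit_le eps (Y : {set J}) : (forall x, \sum_v q x v ^+ 2 <= eps) ->
  \sum_s row_law s * (~~ [disjoint s.2 & Y])%:R <=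
    tilt_cst + eps + \sum_(v in Y) tilt v.
Proof.
move=> he; rewrite sum_row /tilt exchange_big /=.
have -> : eps = \sum_x a x * eps by rewrite -big_distrl /= a_law.2 mul1r.
rewrite /tilt_cst -!big_split; apply: ler_sum => x _ /=.
rewrite -big_distrr /= -!mulrDr ler_wpM2l ?a_law.1 //.
have -> : \sum_S ber (q x) S * (~~ [disjoint S & Y])%:R =
    1 - \prod_(v in Y) (1 - q x v).
  transitivity (\sum_S ber (q x) S - \sum_S ber (q x) S * [disjoint S & Y]%:R).
    rewrite -sumrB; apply: eq_bigr => S _.
    by case: [disjoint S & Y]; rewrite /= ?mulr1 ?mulr0 ?subrr ?subr0.
  by rewrite ber_sum ber_disjoint.
rewrite -big_distrr /=; set s := \sum_(v in Y) q x v.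
have h1 := @prod_ge_expR R J (enum Y) (q x) (q01 x); rewrite !big_enum /= -/s in h1.
have h2 : \sum_(v in Y) q x v ^+ 2 <= eps.
  apply: le_trans (he x); rewrite [leRHS](bigID (mem Y)) /= lerDl.
  by apply: sumr_ge0 => v _; rewrite sqr_ge0.
have h3 := expRN_tangent (z x) s.
rewrite /two_or_more; set P := \prod_(v in Y) _ in h1 *.
by lra.
Qed.

Definition pendant (d : R) (s : row) : R :=
  \sum_v d * tilt v * (s == (x0, [set v]))%:R +
  (1 - d * \sum_v tilt v) * (s == (x0, set0))%:R.

Lemma sum_pendant d (f : row -> R) : \sum_s pendant d s * f s =
  \sum_v d * tilt v * f (x0, [set v]) + (1 - d * \sum_v tilt v) * f (x0, set0).
Proof.
rewrite -[f (x0, set0)](sum_point (x0, set0)) big_distrr /=.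
under [X in _ = X + _]eq_bigr => v _.
  rewrite -[f (x0, [set v])](sum_point (x0, [set v])) big_distrr /=; over.
rewrite exchange_big -big_split; apply: eq_bigr => s _ /=.
rewrite /pendant mulrDl big_distrl /= mulrA; congr (_ + _).
by apply: eq_bigr => v _; rewrite mulrA.
Qed.

Lemma pendant_law d : 0 <= d -> d * (\sum_v tilt v) <= 1 -> is_law (pendant d).
Proof.
move=> d0 d1; split=> [s|].
  rewrite addr_ge0 ?mulr_ge0 ?subr_ge0 //; apply: sumr_ge0 => v _.
  by rewrite !mulr_ge0 ?tilt_ge0.
under eq_bigr => s _ do rewrite -[pendant _ _]mulr1.
rewrite sum_pendant mulr1; under eq_bigr => v _ do rewrite mulr1.
by rewrite -big_distrr /= addrC subrK.
Qed.

Lemma chain_rank_upper n A eps : 0 < A -> (forall x, \sum_v q x v ^+ 2 <= eps) ->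
  chain row_law n (@rankF R J) <=
    n%:R * (tilt_cst + eps) + \sum_v (1 - expR (- (n%:R * tilt v)))
    + n%:R * (\sum_v tilt v ^+ 2) + (A + n%:R / A) / 2.
Proof.
move=> A0 he; set Th := \sum_v tilt v.
have Th0 : 0 <= Th by apply: sumr_ge0 => v _; apply: tilt_ge0.
(* The total weight of [tilt] may exceed 1. Each row is split into [m] lazy ones, active with
   probability [d = 1 / m]: the mean number of active rows remains [n], and [pendant d] becomes a
   law. *)
pose m := (Num.truncn Th).+1.
have mTh : Th <= m%:R by apply: ltW; apply: truncnS_gt.
have m0 : 0 < m%:R :> R by rewrite ltr0n.
pose d : R := m%:R^-1.
have d0 : 0 <= d by rewrite invr_ge0 ltW.
have d1 : d <= 1 by rewrite invf_le1 // ler1n.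
have dTh : d * Th <= 1 by rewrite /d mulrC ler_pdivrMr // mul1r.
have nmd : (n * m)%:R * d = n%:R by rewrite natrM -mulrA mulfV ?mulr1 // gt_eqF.
have h1 := @chain_lazy R X J x0 d row_law n (n * m) 0 A row_law_law.
rewrite d0 d1 in h1; have {h1} := h1 isT A0.
rewrite nmd subr0 subrr expr0n add0r /= -/(chain _ _ _) => h1.
have d01 : 0 <= d <= 1 by rewrite d0 d1.
have lQ := pendant_law d0 dTh.
have h2 := @row_replacement R X J 'I_(n * m) _ _ (d * (tilt_cst + eps))
  (lazy_law x0 d01 row_law_law) lQ.
rewrite card_ord in h2.
have h3 := @chain_rank_hit R X J 'I_(n * m) _ lQ; rewrite card_ord in h3.
have h4 : \sum_v (1 - (\sum_s pendant d s * (v \notin s.2)%:R) ^+ (n * m)) <=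
    \sum_v (1 - expR (- (n%:R * tilt v))) + n%:R * (\sum_v tilt v ^+ 2).
  rewrite big_distrr -big_split; apply: ler_sum => v _ /=.
  have -> : \sum_s pendant d s * (v \notin s.2)%:R = 1 - d * tilt v.
    rewrite sum_pendant inE mulr1.
    have -> : \sum_v0 d * tilt v0 * (v \notin [set v0])%:R = d * Th - d * tilt v.
      rewrite [RHS]addrC /Th [in RHS](bigD1 v) //= mulrDr addrA addNr add0r.
      rewrite (bigD1 v) //= inE eqxx mulr0 add0r big_distrr; apply: eq_bigr => u uv.
      by rewrite inE eq_sym uv mulr1.
    by rewrite addrC addrA subrK.
  have t0 := tilt_ge0 v.
  have t1 : d * tilt v <= 1.
    apply: le_trans dTh; rewrite ler_wpM2l // /Th (bigD1 v) //= lerDl.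
    by apply: sumr_ge0 => u _; apply: tilt_ge0.
  have h := @prod_ge_expR R 'I_(n * m) (index_enum _) (fun=> d * tilt v).
  rewrite prodr_const !sumr_const !card_ord in h.
  have e1 : (d * tilt v) *+ (n * m) = n%:R * tilt v.
    by rewrite -mulr_natl mulrA nmd.
  have e2 : (d * tilt v) ^+ 2 *+ (n * m) <= n%:R * tilt v ^+ 2.
    have -> : (d * tilt v) ^+ 2 *+ (n * m) = (n * m)%:R * d * (d * tilt v ^+ 2).
      by rewrite -mulr_natl; ring.
    by rewrite nmd ler_wpM2l // ler_piMl ?sqr_ge0.
  have {h} : expR (- (n%:R * tilt v)) - (d * tilt v) ^+ 2 *+ (n * m) <=
      (1 - d * tilt v) ^+ (n * m).
    by rewrite -e1; apply: h; rewrite t1 mulr_ge0.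
  by lra.
have {h2} h2 : chain (lazy x0 d row_law) (n * m) (@rankF R J) <=
    (n * m)%:R * (d * (tilt_cst + eps)) + chain (pendant d) (n * m) (@rankF R J).
  apply: h2 => Y; rewrite sum_lazy sum_pendant /= disjoints_subset sub0set /= !mulr0 !addr0.
  have -> : \sum_v d * tilt v * (~~ [disjoint [set v] & Y])%:R = d * \sum_(v in Y) tilt v.
    rewrite [\sum_(v in Y) _]big_mkcond /= big_distrr; apply: eq_bigr => v _ /=.
    by rewrite disjoints1 negbK; case: (v \in Y); rewrite ?mulr1 ?mulr0.
  by rewrite -mulrDr ler_wpM2l // row_hit_le.
rewrite mulrA nmd in h2.
have h5 : n%:R * (1 - d) / A <= n%:R / A.
  by rewrite ler_pM2r ?invr_gt0 // ler_piMr // lerBlDr lerDl.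
by lra.
Qed.

End RowLaw.

(** * Lower bound: stability of the avoidable set *)

Section Miss.
Variables (R : realType) (J : finType) (q : J -> R) (qm : R).
Hypothesis q01 : forall v, 0 <= q v <= qm.
Hypothesis qm0 : 0 <= qm.
Hypothesis qm1 : qm <= 1.
Implicit Types Y Z : {set J}.

Definition load Y : R := \sum_(v in Y) q v.
Definition miss Y : R := \prod_(v in Y) (1 - q v).

Let q01' v : 0 <= q v <= 1.
Proof. by have /andP[-> h] := q01 v; apply: le_trans h qm1. Qed.

Lemma miss_ge0 Y : 0 <= miss Y.
Proof. by apply: prodr_ge0 => v _; rewrite subr_ge0; have /andP[] := q01' v. Qed.

Lemma load_ge0 Y : 0 <= load Y.
Proof. by apply: sumr_ge0 => v _; have /andP[] := q01' v. Qed.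

Lemma load_mono Y Z : Y \subset Z -> load Y <= load Z.
Proof.
move=> YZ; rewrite /load [leRHS](big_setID Y) /= (setIidPr YZ) lerDl.
by apply: sumr_ge0 => v _; have /andP[] := q01' v.
Qed.

Lemma miss_le_expR Y : miss Y <= expR (- load Y).
Proof. by have := prod_le_expR (enum Y) q01'; rewrite !big_enum. Qed.

Lemma miss_le1 Y : miss Y <= 1.
Proof.
by apply: le_trans (miss_le_expR Y) _; rewrite -expR0 ler_expR oppr_le0 load_ge0.
Qed.

Lemma miss_ge_expR Y : expR (- load Y) - \sum_v q v ^+ 2 <= miss Y.
Proof.
have := prod_ge_expR (enum Y) q01'; rewrite !big_enum /=; apply: le_trans.
rewrite lerD2l lerN2 [leRHS](bigID (mem Y)) /= lerDl.
by apply: sumr_ge0 => v _; rewrite sqr_ge0.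
Qed.

Lemma miss_anti Y Z : Y \subset Z -> miss Z <= miss Y.
Proof.
move=> YZ; rewrite /miss [leLHS](big_setID Y) /= (setIidPr YZ) ler_piMr ?miss_ge0 //.
exact: miss_le1.
Qed.

Lemma miss_drop Y Z : Y \subset Z -> miss Y <= miss Z + qm * (#|Z|%:R - #|Y|%:R).
Proof.
move=> YZ; have -> : miss Z = miss Y * miss (Z :\: Y).
  by rewrite /miss [LHS](big_setID Y) /= (setIidPr YZ).
have h1 : 1 - qm * (#|Z|%:R - #|Y|%:R) <= miss (Z :\: Y).
  have -> : #|Z|%:R - #|Y|%:R = #|Z :\: Y|%:R :> R.
    by rewrite -(cardsID Y Z) (setIidPr YZ) natrD addrC addKr.
  elim/set_ind: (Z :\: Y) => [|v W vW IH].
    by rewrite cards0 mulr0 subr0 /miss big_set0.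
  rewrite cardsU1 vW natrD mulrDr mulr1 /miss big_setU1 //= -/(miss W).
  have /andP[v0 v1] := q01 v; have m1 := miss_le1 W.
  have k1 : 0 <= q v * (1 - miss W) by rewrite mulr_ge0 // subr_ge0.
  by lra.
have m1 := miss_le1 Y; have m0 := miss_ge0 Y.
have : 0 <= qm * (#|Z|%:R - #|Y|%:R).
  by rewrite mulr_ge0 // subr_ge0 ler_nat subset_leq_card.
set d := qm * _ in h1 * => d0.
have k1 : 0 <= miss Y * (miss (Z :\: Y) - 1 + d) by rewrite mulr_ge0 //; lra.
have k2 : 0 <= d * (1 - miss Y) by rewrite mulr_ge0 // subr_ge0.
by lra.
Qed.

End Miss.

Section LowerBound.
Variables (R : realType) (X J : finType) (a : X -> R) (q : X -> J -> R).
Variables (qm eps : R).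
Hypothesis a_law : is_law a.
Hypothesis q_ge0 : forall x v, 0 <= q x v <= qm.
Hypothesis qm0 : 0 <= qm.
Hypothesis qm_half : 2 * qm <= 1.
Hypothesis q_sqr : forall x, \sum_v q x v ^+ 2 <= eps.
Local Notation row := (X * {set J})%type.
Local Notation mu := (row_law a q).
Implicit Types (F : ({set J} -> nat) -> R) (rho : {set J} -> nat) (Y Z : {set J}).

Let qm1 : qm <= 1. Proof. by move: qm0 qm_half; lra. Qed.

Let q01 x v : 0 <= q x v <= 1.
Proof. by have /andP[-> h] := q_ge0 x v; apply: le_trans h qm1. Qed.

Let mu_law : is_law mu := row_law_law a_law q01.

Definition avoidF rho : R := #|avoidable rho|%:R.
(* Nonnegative and telescoping, with total at most [#|J|]: for most [k] the
   avoidable set is stable under the addition of one row. *)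
Definition loss k : R := chain mu k.-1 avoidF - chain mu k avoidF.

Section Slots.
Variable I : finType.
Local Notation E := (pE (fun _ : I => mu)).
Implicit Types (w : {ffun I -> row}) (u : I).

Definition avoid (A : {set I}) w : {set J} := avoidable (rk (nb w) A).

Lemma E_avoid (A : {set I}) (g : {set J} -> R) :
  E (fun w => g (avoid A w)) = chain mu #|A| (fun rho => g (avoidable rho)).
Proof. exact: (@pE_chain R X J I mu A (fun rho => g (avoidable rho))). Qed.

Lemma avoid_setU1 w u (A : {set I}) : u \notin A ->
  avoid (u |: A) w = avoidable (ext (rk (nb w) A) (nb w u)).
Proof.
by move=> uA; congr avoidable; apply: funext => B; rewrite rk_setU1.
Qed.

Lemma avoid_sub w u (A : {set I}) : u \notin A -> avoid (u |: A) w \subset avoid A w.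
Proof. by move=> uA; rewrite avoid_setU1 //; apply: avoidable_ext; apply: rk_rank_fun. Qed.

Lemma avoid_upd w u s (A : {set I}) : u \notin A -> avoid A (upd w u s) = avoid A w.
Proof. by move=> uA; rewrite /avoid rk_upd. Qed.

Lemma avoid_upd_setU1 w u s (A : {set I}) : u \notin A ->
  avoid (u |: A) (upd w u s) = avoidable (ext (rk (nb w) A) s.2).
Proof. by move=> uA; rewrite /avoid rk_upd_setU1. Qed.

Lemma E_loss u (A : {set I}) : u \notin A ->
  E (fun w => #|avoid A w|%:R - #|avoid (u |: A) w|%:R) = loss (#|A|.+1).
Proof.
move=> uA; rewrite pEB (E_avoid A (fun Y => #|Y|%:R)).
by rewrite (E_avoid (u |: A) (fun Y => #|Y|%:R)) cardsU1 uA.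
Qed.

Lemma E_ge0 (f : {ffun I -> row} -> R) : (forall w, 0 <= f w) -> 0 <= E f.
Proof. by move=> f0; apply: pE_ge0 => // _; apply: mu_law.1. Qed.

Lemma ler_E (f g : {ffun I -> row} -> R) : (forall w, f w <= g w) -> E f <= E g.
Proof. by move=> fg; apply: ler_pE => // _; apply: mu_law.1. Qed.

Lemma E_cst (c : R) : E (fun=> c) = c.
Proof. by apply: pE_cst => _; apply: mu_law.2. Qed.

(* For [A] the complement of [u], these are the rows of type [x] left uncovered
   by some maximum matching. *)
Definition idle x (A : {set I}) u w : R :=
  (((w u).1 == x) && [disjoint nb w u & avoid A w])%:R.

Lemma sum_row_idle x Y : \sum_s mu s * ((s.1 == x) && [disjoint s.2 & Y])%:R =
  a x * miss (q x) Y.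
Proof.
rewrite sum_row (bigD1 x) //= [X in _ + X]big1 ?addr0.
  congr (_ * _); rewrite /miss -ber_disjoint; apply: eq_bigr => S _.
  by rewrite eqxx.
move=> y /negbTE yx; rewrite big1 ?mulr0 // => S _.
by rewrite yx mulr0.
Qed.

Lemma idle_upd x (A : {set I}) u w s : u \notin A ->
  idle x A u (upd w u s) = ((s.1 == x) && [disjoint s.2 & avoid A w])%:R.
Proof. by move=> uA; rewrite /idle avoid_upd // /nb upd_same. Qed.

(** An idle row leaves the avoidable set as it was ([avoidable_ext_disjoint]), so [g] may be
    evaluated before row [u] is added, where it is independent of that row. This makes the cross
    term of the variance exact. *)
Lemma E_idle x (A : {set I}) u (g : {set J} -> R) : u \notin A ->
  E (fun w => idle x A u w * g (avoid (u |: A) w)) =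
  a x * chain mu #|A| (fun rho => miss (q x) (avoidable rho) * g (avoidable rho)).
Proof.
move=> uA; rewrite (pE_resample1 u) ?mu_law.2 //.
rewrite -(E_avoid A (fun Y => miss (q x) Y * g Y)) -pEZ; apply: eq_pE => w.
rewrite mulrA -sum_row_idle big_distrl; apply: eq_bigr => s _ /=.
rewrite idle_upd // avoid_upd_setU1 //.
have [d|_] := boolP [disjoint s.2 & avoid A w]; last by rewrite andbF !(mul0r, mulr0).
by rewrite (avoidable_ext_disjoint (rk_rank_fun _ _) d) mulrA.
Qed.

Lemma loss_ge0_slots u (A : {set I}) : u \notin A -> 0 <= loss (#|A|.+1).
Proof.
move=> uA; rewrite -(E_loss uA); apply: E_ge0 => w.
by rewrite subr_ge0 ler_nat subset_leq_card // avoid_sub.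
Qed.

Definition missF x rho : R := miss (q x) (avoidable rho) ^+ 2.

Lemma missF_drop x u (A : {set I}) : u \notin A ->
  chain mu #|A| (missF x) <= chain mu #|A|.+1 (missF x)
  <= chain mu #|A| (missF x) + 2 * qm * loss (#|A|.+1).
Proof.
move=> uA; rewrite -(E_loss uA) -pEZ.
rewrite -(E_avoid A (fun Y => miss (q x) Y ^+ 2)).
have -> : chain mu #|A|.+1 (missF x) = E (fun w => miss (q x) (avoid (u |: A) w) ^+ 2).
  by rewrite (E_avoid (u |: A) (fun Y => miss (q x) Y ^+ 2)) cardsU1 uA.
rewrite -pED; apply/andP; split; apply: ler_E => w.
  rewrite lerXn2r ?nnegrE ?(miss_ge0 (q_ge0 x) qm1) //.
  by apply: (miss_anti (q_ge0 x) qm1); apply: avoid_sub.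
have h := miss_drop (q_ge0 x) qm0 qm1 (avoid_sub w uA).
have h0 := miss_ge0 (q_ge0 x) qm1; have h1 := miss_le1 (q_ge0 x) qm1.
have h2 := miss_anti (q_ge0 x) qm1 (avoid_sub w uA).
move: h h2 (h0 (avoid A w)) (h1 (avoid A w)) (h1 (avoid (u |: A) w)).
set m := miss _ _; set m' := miss _ _; set d := qm * _ => k1 k2 k3 k4 k5.
have -> : 2 * qm * (#|avoid A w|%:R - #|avoid (u |: A) w|%:R) = 2 * d by rewrite /d mulrA.
have k6 : 0 <= (m' + d - m) * (m + m') by rewrite mulr_ge0 //; lra.
have k7 : 0 <= d * (2 - m - m') by rewrite mulr_ge0 //; lra.
by lra.
Qed.

Lemma sum_row_hit Y : \sum_s mu s * #|s.2 :&: Y|%:R <= qm * #|Y|%:R.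
Proof.
have e (S : {set J}) : #|S :&: Y|%:R = \sum_(v in Y) (v \in S)%:R :> R.
  rewrite -sum1_card natr_sum (eq_bigl (fun v => (v \in Y) && (v \in S))).
    by rewrite big_mkcondr; apply: eq_bigr => v _; case: (v \in S).
  by move=> v; rewrite inE andbC.
have -> : qm * #|Y|%:R = \sum_x a x * \sum_(v in Y) qm.
  by rewrite -big_distrl /= a_law.2 mul1r sumr_const mulr_natr.
rewrite sum_row; apply: ler_sum => x _; rewrite ler_wpM2l ?a_law.1 //.
under eq_bigr => S _ do rewrite e big_distrr /=.
rewrite exchange_big; apply: ler_sum => v _.
have /= := @ber_in R J (q x) v (fun=> 1) (fun=> erefl).
under eq_bigr => S _ do rewrite mulr1.
move=> ->; under eq_bigr => S _ do rewrite mulr1.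
by rewrite ber_sum mulr1; have /andP[] := q_ge0 x v.
Qed.

(** Each indicator depends on the other row through the avoidable set. Both are compared with
    idleness relative to [A], for which the two rows are independent given those of [A]. The
    difference [drop] counts neighbours of one row among the columns that the other removes, whose
    mean number is the loss. *)
Lemma E_idle2 x (A : {set I}) u u' : u \notin A -> u' \notin A -> u != u' ->
  E (fun w => idle x (u' |: A) u w * idle x (u |: A) u' w) <=
  a x ^+ 2 * chain mu #|A| (missF x) + 2 * qm * loss (#|A|.+1).
Proof.
move=> uA u'A uu'.
have uA' : u \notin u' |: A by rewrite !inE negb_or uu'.
pose drop y z w := #|nb w y :&: (avoid A w :\: avoid (z |: A) w)|%:R : R.
have cov y z w : idle x (z |: A) y w <= idle x A y w + drop y z w.
  rewrite /idle /drop; case: eqP => _ /=; last by rewrite add0r ler0n.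
  case: (boolP [disjoint _ & avoid (z |: A) w]) => d1; last by rewrite addr_ge0.
  case: (boolP [disjoint _ & avoid A w]) => d2; first by rewrite lerDl.
  rewrite add0r ler_nat card_gt0; move/pred0Pn: d2 => [v /= /andP[v1 v2]].
  by apply/set0Pn; exists v; rewrite in_setI v1 in_setD (disjointFr d1 v1).
have i01 y w (B : {set I}) : 0 <= idle x B y w <= 1.
  by rewrite /idle ler0n lern1 leq_b1.
have Edrop y z : y \notin A -> z \notin A -> y != z ->
    E (drop y z) <= qm * loss (#|A|.+1).
  move=> yA zA yz; rewrite -(E_loss zA) -pEZ (pE_resample1 y) ?mu_law.2 //.
  have yzA : y \notin z |: A by rewrite !inE negb_or yz.
  apply: ler_E => w.
  rewrite -(cardsID (avoid (z |: A) w) (avoid A w)) (setIidPr (avoid_sub w zA)).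
  rewrite natrD addrC addKr; apply: le_trans (sum_row_hit _).
  by apply: ler_sum => s _; rewrite /drop !avoid_upd // /nb upd_same.
have -> : a x ^+ 2 * chain mu #|A| (missF x) = E (fun w => idle x A u w * idle x A u' w).
  rewrite (pE_resample1 u) ?mu_law.2 // (pE_resample1 u') ?mu_law.2 //.
  rewrite -(E_avoid A (fun Y => miss (q x) Y ^+ 2)) -pEZ; apply: eq_pE => w.
  have -> : a x ^+ 2 * miss (q x) (avoid A w) ^+ 2 =
      (a x * miss (q x) (avoid A w)) * (a x * miss (q x) (avoid A w)) by ring.
  rewrite -{1}sum_row_idle big_distrl; apply: eq_bigr => s _ /=.
  rewrite -mulrA; congr (_ * _); rewrite -sum_row_idle big_distrr; apply: eq_bigr => s0 _ /=.
  rewrite idle_upd // avoid_upd // mulrCA; congr (_ * _); rewrite mulrC; congr (_ * _).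
  by rewrite /idle !avoid_upd // /nb upd_other ?upd_same // eq_sym.
have h1 := Edrop u u' uA u'A uu'.
have h2 : E (drop u' u) <= qm * loss (#|A|.+1) by apply: Edrop => //; rewrite eq_sym.
apply: (@le_trans _ _ (E (fun w => idle x A u w * idle x A u' w + (drop u u' w + drop u' u w)))).
  apply: ler_E => w; have c1 := cov u u' w; have c2 := cov u' u w.
  have /andP[p1 p2] := i01 u w A; have /andP[p3 p4] := i01 u' w A.
  have /andP[p5 p6] := i01 u w (u' |: A); have /andP[p7 p8] := i01 u' w (u |: A).
  have p9 : 0 <= drop u u' w by apply: ler0n.
  have p10 : 0 <= drop u' u w by apply: ler0n.
  move: c1 c2 p1 p2 p3 p4 p5 p6 p7 p8 p9 p10.
  move: (idle x (u' |: A) u w) (idle x A u w) (idle x A u' w) (idle x (u |: A) u' w).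
  move: (drop u u' w) (drop u' u w) => d1 d2 x1 x2 x3 x4.
  move=> *.
  have k1 : 0 <= x4 * (x2 + d1 - x1) by rewrite mulr_ge0 //; lra.
  have k2 : 0 <= d1 * (1 - x4) by rewrite mulr_ge0 //; lra.
  have k3 : 0 <= x2 * (x3 + d2 - x4) by rewrite mulr_ge0 //; lra.
  have k4 : 0 <= d2 * (1 - x2) by rewrite mulr_ge0 //; lra.
  by lra.
by rewrite pED lerD2l pED; lra.
Qed.


Definition idleN x w : R := \sum_u idle x (~: [set u]) u w.

Lemma setU1C (u : I) : u |: ~: [set u] = setT.
Proof. by apply/setP=> i; rewrite !inE orbN. Qed.

Lemma notin_setC1 (u : I) : u \notin ~: [set u].
Proof. by rewrite !inE eqxx. Qed.

Lemma card_setC1 (u : I) : #|~: [set u]|.+1 = #|I|.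
Proof. by rewrite -cardsT -(setU1C u) cardsU1 notin_setC1. Qed.

(** * Exposing one right vertex *)

Section Column.
Variable v : J.

(** Missed by some maximum matching once [v] is deleted from the graph. Idleness, by contrast, may
    depend on the edges at [v]. *)
Definition spare w u : bool := rk (nb w) setT (setT :\ v) == rk (nb w) (setT :\ u) (setT :\ v).

(* Rows in [W] carry their true bit at [v], the others its mean. The rows can be
   switched one at a time because [spare] ignores all bits at [v]. *)
Definition hybrid (W : {set I}) w : R :=
  \prod_u (1 - (spare w u)%:R * (if u \in W then (v \in nb w u)%:R else q (w u).1 v)).

Lemma hybridE (W : {set I}) u : u \notin W -> E (hybrid (u |: W)) = E (hybrid W).
Proof.
move=> uW; rewrite (pE_resample1 u) ?mu_law.2 // [RHS](pE_resample1 u) ?mu_law.2 //.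
apply: eq_pE => w; rewrite !sum_row; apply: eq_bigr => x _; congr (_ * _).
pose B S := \prod_(i | i != u) (1 - (spare (upd w u (x, S)) i)%:R *
  (if i \in W then (v \in nb w i)%:R else q (w i).1 v)).
pose sp (S : {set J}) : R := (spare (upd w u (x, S)) u)%:R.
have spv (S : {set J}) i : spare (upd w u (x, S :\ v)) i = spare (upd w u (x, S)) i.
  rewrite /spare; congr (_ == _); apply: rk_eq => y _; rewrite /nb !ffunE;
  by case: eqP => //= _; apply/setP=> j; rewrite !inE; case: eqP => //=; rewrite ?andbF.
have BE (W' : {set I}) S : (forall i, i != u -> (i \in W') = (i \in W)) ->
    hybrid W' (upd w u (x, S)) = (1 - sp S *
      (if u \in W' then (v \in S)%:R else q x v)) * B S.
  move=> WW; rewrite /hybrid (bigD1 u) //= /nb upd_same /=; congr (_ * _).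
  by apply: eq_bigr => i iu; rewrite upd_other // WW.
under eq_bigr => S _.
  rewrite BE; last by move=> i iu; rewrite !inE (negbTE iu).
  rewrite !inE eqxx /= mulrBl mul1r mulrBr -mulrA (mulrCA (sp S)); over.
under [RHS]eq_bigr => S _.
  rewrite BE // (negbTE uW) mulrBl mul1r mulrBr -mulrA (mulrCA (sp S)) [X in _ - X]mulrCA; over.
rewrite !sumrB -big_distrr /= (@ber_in R J (q x) v (fun S => sp S * B S)) // => S.
by rewrite /sp /B spv; congr (_ * _); apply: eq_bigr => i _; rewrite spv.
Qed.

(** If [v] is avoidable, no spare row is adjacent to it ([avoidable_not_adj]), so the indicator is
    at most [hybrid setT]. Averaging the bits at [v] leads to [hybrid set0], and every idle row is
    spare ([disjoint_setD1]). *)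
Lemma E_avoidable_le : E (fun w => (v \in avoid setT w)%:R) <=
  E (fun w => expR (- \sum_x q x v * idleN x w)).
Proof.
have h0 : E (hybrid setT) = E (hybrid set0).
  by elim/set_ind: setT => // u W uW <-; rewrite hybridE.
apply: (@le_trans _ _ (E (hybrid setT))).
  apply: ler_E => w; rewrite /hybrid; case vD: (v \in avoid setT w) => /=.
    rewrite big1 // => u _; rewrite inE.
    case sp: (spare w u); last by rewrite mul0r subr0.
    case vu: (v \in nb w u); last by rewrite mulr0 subr0.
    by have := avoidable_not_adj vD vu; rewrite -/(spare w u) sp.
  apply: prodr_ge0 => u _; rewrite inE.
  by case: (spare w u); case: (v \in nb w u); rewrite /= ?mulr0 ?mulr1 ?subr0 ?subrr.
rewrite h0; apply: ler_E => w.
have sumE : \sum_x q x v * idleN x w =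
    \sum_u [disjoint nb w u & avoid (~: [set u]) w]%:R * q (w u).1 v.
  rewrite /idleN; under eq_bigr => x _ do rewrite big_distrr /=.
  rewrite exchange_big; apply: eq_bigr => u _ /=.
  rewrite (bigD1 (w u).1) //= big1 ?addr0; first by rewrite /idle eqxx mulrC.
  by move=> x xu; rewrite /idle eq_sym (negbTE xu) mulr0.
rewrite sumE -sumrN expR_sum /hybrid; apply: ler_prod => u _; rewrite inE.
have /andP[q0 q1] := q01 (w u).1 v.
apply/andP; split; first by case: spare; rewrite ?mul1r ?mul0r ?subr0 ?subr_ge0.
apply: le_trans (expR_ge1Dx _); rewrite lerD2l lerN2 ler_wpM2r // ler_nat.
have [d|//] := boolP [disjoint _ & _]; suff -> : spare w u by [].
rewrite /spare; apply/eqP; apply: disjoint_setD1.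
by move: d; rewrite /avoid setTD.
Qed.

End Column.

End Slots.

Let a_le1 x : a x <= 1.
Proof.
rewrite -a_law.2 (bigD1 x) //= lerDl; apply: sumr_ge0 => y _; exact: a_law.1.
Qed.

Lemma loss_ge0 k : 0 <= loss k.
Proof.
case: k => [|k]; first by rewrite /loss subrr.
have := loss_ge0_slots (notin_setC1 (ord0 : 'I_k.+1)).
by rewrite card_setC1 card_ord.
Qed.

Section MoreSlots.
Variable I : finType.
Local Notation E := (pE (fun _ : I => mu)).
Local Notation k := #|I|.
Implicit Types (w : {ffun I -> row}) (u : I).

Lemma idleN_variance x : (0 < k)%N ->
  E (fun w => (idleN x w - k%:R * a x * miss (q x) (avoid setT w)) ^+ 2) <=
  k%:R + 2 * k%:R ^+ 2 * qm * (loss k.-1 + loss k).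
Proof.
(* All three terms of the expanded square are compared with the same [c], the second moment of
   [miss] at [k - 1] rows; the contributions of order [k ^ 2 * c] then cancel as [1 - 2 + 1]. *)
move=> k0; set c := chain mu k.-1 (missF x); set K : R := k%:R.
have K0 : 0 <= K by apply: ler0n.
have l0 := loss_ge0 k.-1; have l1 := loss_ge0 k.
have c0 : 0 <= c.
  have [u _] : exists u : I, true by have /card_gt0P[u _] := k0; exists u.
  have ck : k.-1 = #|~: [set u]| by rewrite -(card_setC1 u).
  rewrite /c ck -(E_avoid (~: [set u]) (fun Y => miss (q x) Y ^+ 2)).
  by apply: (E_ge0) => w; rewrite sqr_ge0.
have hc : E (fun w => miss (q x) (avoid setT w) ^+ 2) <= c + 2 * qm * loss k.
  have [u _] : exists u : I, true by have /card_gt0P[u _] := k0; exists u.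
  rewrite (E_avoid setT (fun Y => miss (q x) Y ^+ 2)) cardsT.
  have := missF_drop x (notin_setC1 u); rewrite card_setC1.
  have -> : #|~: [set u]| = k.-1 by rewrite -(card_setC1 u).
  by move=> /andP[].
have hx : E (fun w => idleN x w * miss (q x) (avoid setT w)) = K * a x * c.
  transitivity (\sum_(u : I) a x * c); last by rewrite sumr_const -mulr_natl mulrA.
  transitivity (E (fun w => \sum_u idle x (~: [set u]) u w * miss (q x) (avoid setT w))).
    by apply: eq_pE => w; rewrite big_distrl.
  rewrite pE_sum; apply: eq_bigr => u _; rewrite -(setU1C u).
  rewrite (E_idle x (miss (q x)) (notin_setC1 u)) /c.
  by have -> : #|~: [set u]| = k.-1 by rewrite -(card_setC1 u).
have hy : E (fun w => idleN x w ^+ 2) <=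
    K + K ^+ 2 * (a x ^+ 2 * c + 2 * qm * loss k.-1).
  have -> : E (fun w => idleN x w ^+ 2) =
      \sum_u \sum_u' E (fun w => idle x (~: [set u]) u w * idle x (~: [set u']) u' w).
    under [RHS]eq_bigr => u _ do rewrite -pE_sum.
    rewrite -pE_sum; apply: eq_pE => w; rewrite expr2 /idleN big_distrl.
    by apply: eq_bigr => u _; rewrite big_distrr.
  have G0 : 0 <= a x ^+ 2 * c + 2 * qm * loss k.-1.
    apply: addr_ge0; first exact: mulr_ge0 (sqr_ge0 _) c0.
    by rewrite mulr_ge0 // mulr_ge0.
  set G := _ + _ in G0 *.
  apply: (@le_trans _ _ (\sum_(u : I) (1 + \sum_(u' : I) G))); last first.
    by rewrite big_split /= !sumr_const -(mulr_natl G) -(mulr_natl (_ * G)) mulrA -expr2.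
  apply: ler_sum => u _; rewrite (bigD1 u) //=; apply: lerD.
    rewrite -[leRHS](E_cst I 1).
    apply: (ler_E) => w; rewrite /idle.
    by case: (_ && _); rewrite ?mulr1 ?mulr0.
  rewrite [leRHS](bigD1 u) //= -[leLHS]add0r lerD //; apply: ler_sum => u' u'u.
  (* A pair leaves [k - 2] other rows: hence [loss k.-1], and the monotone half of [missF_drop] to
     return to [c]. *)
  pose A := ~: [set u; u'].
  have uA : u \notin A by rewrite !inE eqxx.
  have u'A : u' \notin A by rewrite !inE eqxx orbT.
  have e1 : u' |: A = ~: [set u].
    by apply/setP=> i; rewrite !inE; have [->|] := eqVneq i u'; rewrite ?u'u //= orbF.
  have e2 : u |: A = ~: [set u'].
    by apply/setP=> i; rewrite !inE; have [->|] := eqVneq i u; rewrite //= eq_sym u'u.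
  have cA : #|A|.+1 = k.-1.
    by rewrite -(card_setC1 u) -e1 cardsU1 u'A.
  rewrite -e1 -e2; apply: le_trans (E_idle2 x uA u'A _) _.
    by rewrite eq_sym.
  rewrite cA /G lerD2r ler_wpM2l ?sqr_ge0 // /c -cA.
  by have /andP[] := missF_drop x uA.
have -> : E (fun w => (idleN x w - K * a x * miss (q x) (avoid setT w)) ^+ 2) =
    E (fun w => idleN x w ^+ 2) - 2 * K * a x * E (fun w => idleN x w * miss (q x) (avoid setT w))
    + (K * a x) ^+ 2 * E (fun w => miss (q x) (avoid setT w) ^+ 2).
  rewrite -!pEZ -pEB -pED; apply: eq_pE => w; ring.
rewrite hx.
have h1 : (K * a x) ^+ 2 * E (fun w => miss (q x) (avoid setT w) ^+ 2) <=
    (K * a x) ^+ 2 * (c + 2 * qm * loss k) by rewrite ler_wpM2l ?sqr_ge0.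
have h2 : K ^+ 2 * (2 * qm * loss k) * (1 - a x ^+ 2) >= 0.
  rewrite !mulr_ge0 ?sqr_ge0 // subr_ge0 -[1](expr1n _ 2) lerXn2r ?nnegrE //.
  exact: a_law.1.
by lra.
Qed.


(* If [S] meets the old avoidable set but not the new one, then any [v] in the
   former intersection either is alone there, or has just become unavoidable
   because of the other elements of [S]. *)
Lemma busy_row rho (S : {set J}) : rank_fun rho ->
  1 - [disjoint S & avoidable rho]%:R
    - \sum_(v in avoidable rho) (v \in S)%:R *
        ([disjoint S :\ v & avoidable rho]%:R + (v \notin avoidable (ext rho (S :\ v)))%:R)
  <= (~~ [disjoint S & avoidable (ext rho S)])%:R :> R.
Proof.
move=> rr; set Y := avoidable rho; set C := \sum_(v in Y) _.
have C0 : 0 <= C by apply: sumr_ge0 => v _; rewrite mulr_ge0 ?addr_ge0.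
have [d|nd] := boolP [disjoint S & Y].
  by rewrite subrr sub0r; apply: le_trans (ler0n _ _); rewrite oppr_le0.
rewrite subr0; have [d'|_] := boolP [disjoint S & avoidable (ext rho S)]; last first.
  by rewrite /= lerBlDr lerDl.
rewrite /= subr_le0; case/pred0Pn: nd => v /= /andP[vS vY].
rewrite /C (bigD1 v) //= vS mul1r -[leLHS]addr0; apply: lerD; last first.
  by apply: sumr_ge0 => u _; rewrite mulr_ge0 ?addr_ge0.
have [_|nd] := boolP [disjoint S :\ v & Y]; first by rewrite lerDl.
rewrite add0r; have [h|//] := boolP (v \in _).
have := avoidable_ext_setU rr nd h; rewrite setD1K // => h'.
by rewrite (disjointFr d' vS) in h'.
Qed.

(** By [busy_row], a row with at least two neighbours in the old avoidable set also meets the new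
    one, unless those neighbours have become unavoidable; the exception is charged to the mean
    shrinkage. *)
Lemma row_busy_ge rho : rank_fun rho ->
  \sum_x a x * two_or_more (load (q x) (avoidable rho)) - 2 * eps
    - 2 * qm * (\sum_s mu s * (#|avoidable rho|%:R - #|avoidable (ext rho s.2)|%:R)) <=
  \sum_s mu s * (~~ [disjoint s.2 & avoidable (ext rho s.2)])%:R.
Proof.
move=> rr; set Y := avoidable rho.
pose H v (S : {set J}) : R := [disjoint S & Y]%:R + (v \notin avoidable (ext rho S))%:R.
have H0 v S : 0 <= H v S by rewrite addr_ge0.
(* The bit at [v] is independent of [S :\ v]. Trading [S :\ v] for [S] conditioned on missing [v]
   costs a factor [1 / (1 - q x v)], at most 2 by [qm_half]; this is the origin of the factors 2. *)
have hv x v : \sum_S ber (q x) S * ((v \in S)%:R * H v (S :\ v)) <=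
    q x v * miss (q x) Y + 2 * q x v ^+ 2 +
    2 * qm * \sum_S ber (q x) S * (v \notin avoidable (ext rho S))%:R.
  have hD (S : {set J}) : H v (S :\ v :\ v) = H v (S :\ v).
    by congr (H v _); apply/setP=> j; rewrite !inE andbA andbb.
  have b0 S := ber_ge0 S (q01 x).
  have hin := @ber_in R J (q x) v (fun S => H v (S :\ v)) hD.
  have hout := @ber_notin R J (q x) v (fun S => H v (S :\ v)) hD.
  rewrite hin.
  have hle : \sum_S ber (q x) S * ((v \notin S)%:R * H v (S :\ v)) <=
      miss (q x) Y + \sum_S ber (q x) S * (v \notin avoidable (ext rho S))%:R.
    rewrite /miss -ber_disjoint -big_split; apply: ler_sum => S _ /=.
    rewrite -mulrDr ler_wpM2l //; case: (boolP (v \in S)) => vS /=.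
      by rewrite mul0r H0.
    by rewrite mul1r; have -> : S :\ v = S by apply/setDidPl; rewrite disjoint_sym disjoints1.
  rewrite hout in hle; have /andP[v0 v1] := q_ge0 x v.
  have m0 := miss_ge0 (q_ge0 x) qm1 Y; have m1 := miss_le1 (q_ge0 x) qm1 Y.
  set T := \sum_S _ in hle *; set P := \sum_S _ in hle *; set m := miss _ _ in hle m0 m1 *.
  have T0 : 0 <= T by apply: sumr_ge0 => S _; rewrite mulr_ge0.
  have P0 : 0 <= P by apply: sumr_ge0 => S _; rewrite mulr_ge0.
  have k1 : 2 * q x v <= 1 by move: qm_half; lra.
  have k2 : T <= 2 * (m + P).
    have : 0 <= (1 - 2 * q x v) * T by rewrite mulr_ge0 // subr_ge0.
    by lra.
  have k3 : 0 <= q x v ^+ 2 * (2 * (m + P) - T) by rewrite mulr_ge0 ?sqr_ge0 // subr_ge0.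
  have k4 : 0 <= q x v ^+ 2 * (1 - m) by rewrite mulr_ge0 ?sqr_ge0 // subr_ge0.
  have k5 : 0 <= q x v * (m + P - (1 - q x v) * T) by rewrite mulr_ge0 // subr_ge0.
  have k6 : 0 <= q x v * P * (1 - 2 * q x v) by rewrite !mulr_ge0 // subr_ge0.
  have k7 : 0 <= (qm - q x v) * P by rewrite mulr_ge0 // subr_ge0.
  by lra.
apply: (@le_trans _ _ (\sum_s mu s * (1 - [disjoint s.2 & Y]%:R
    - \sum_(v in Y) (v \in s.2)%:R * H v (s.2 :\ v)))); last first.
  by apply: ler_sum => s _; rewrite ler_wpM2l ?mu_law.1 // busy_row.
rewrite !sum_row.
have -> : 2 * eps = \sum_x a x * (2 * eps) by rewrite -big_distrl /= a_law.2 mul1r.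
rewrite big_distrr -!sumrB; apply: ler_sum => x _ /=.
rewrite [2 * qm * _]mulrCA -!mulrBr ler_wpM2l ?a_law.1 //.
have e1 : \sum_S ber (q x) S * (1 - [disjoint S & Y]%:R
      - \sum_(v in Y) (v \in S)%:R * H v (S :\ v)) =
    1 - miss (q x) Y - \sum_(v in Y) \sum_S ber (q x) S * ((v \in S)%:R * H v (S :\ v)).
  transitivity (\sum_S ber (q x) S - \sum_S ber (q x) S * [disjoint S & Y]%:R -
      \sum_S ber (q x) S * \sum_(v in Y) (v \in S)%:R * H v (S :\ v)).
    by rewrite -!sumrB; apply: eq_bigr => S _; rewrite !mulrBr mulr1.
  rewrite ber_sum ber_disjoint; congr (_ - _); rewrite exchange_big.
  by apply: eq_bigr => S _; rewrite big_distrr.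
rewrite e1.
have e2 : \sum_(v in Y) \sum_S ber (q x) S * ((v \in S)%:R * H v (S :\ v)) <=
    load (q x) Y * miss (q x) Y + 2 * eps +
    2 * qm * \sum_S ber (q x) S * (#|Y|%:R - #|avoidable (ext rho S)|%:R).
  apply: le_trans (ler_sum _ (fun v _ => hv x v)) _.
  rewrite !big_split /= -big_distrl -!big_distrr /= -/(load _ _) -addrA -[leRHS]addrA lerD2l.
  apply: lerD.
    rewrite ler_pM2l ?ltr0n //; apply: le_trans (q_sqr x).
    rewrite [leRHS](bigID (mem Y)) /= lerDl.
    by apply: sumr_ge0 => v _; rewrite sqr_ge0.
  rewrite ler_wpM2l ?mulr_ge0 // exchange_big; apply: ler_sum => S _ /=.
  rewrite -big_distrr ler_wpM2l ?ber_ge0 //=.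
  have sY := avoidable_ext S rr.
  rewrite -(cardsID (avoidable (ext rho S)) Y) (setIidPr sY) natrD addrC addKr.
  rewrite -sum1_card natr_sum le_eqVlt.
  apply/orP; left; apply/eqP.
  rewrite [RHS](eq_bigl (fun v => (v \in Y) && (v \notin avoidable (ext rho S)))).
    by rewrite big_mkcondr; apply: eq_bigr => v _; case: (v \in avoidable _).
  by move=> v; rewrite in_setD andbC.
have h3 := miss_le_expR (q_ge0 x) qm1 Y; have h4 := load_ge0 (q_ge0 x) qm1 Y.
rewrite /two_or_more; move: e2 h3 h4.
set l := load _ _; set m := miss _ _ => e2 h3 h4.
have k1 : 0 <= (expR (- l) - m) * (1 + l) by rewrite mulr_ge0 ?subr_ge0 // addr_ge0.
by lra.
Qed.


(** The load is taken after row [u] has been added: the avoidable set only shrinks and [two_or_more]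
    is increasing, so the lower bound survives, and both terms of [G] can share the same [z]. *)
Lemma E_busy u : E (fun w => (~~ [disjoint nb w u & avoid setT w])%:R) >=
  E (fun w => \sum_x a x * two_or_more (load (q x) (avoid setT w))) - 2 * eps
    - 2 * qm * loss k.
Proof.
pose A := ~: [set u]; have uA : u \notin A := notin_setC1 u.
have -> : loss k = E (fun w => \sum_s mu s *
    (#|avoid A w|%:R - #|avoidable (ext (rk (nb w) A) s.2)|%:R)).
  have <- : #|A|.+1 = k by apply: card_setC1.
  rewrite -(E_loss uA) (pE_resample1 u) ?mu_law.2 //; apply: eq_pE => w.
  by apply: eq_bigr => s _; rewrite avoid_upd // avoid_upd_setU1.
have -> : E (fun w => (~~ [disjoint nb w u & avoid setT w])%:R) =
    E (fun w => \sum_s mu s * (~~ [disjoint s.2 & avoidable (ext (rk (nb w) A) s.2)])%:R).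
  rewrite (pE_resample1 u) ?mu_law.2 //; apply: eq_pE => w; apply: eq_bigr => s _.
  by rewrite -{1}(setU1C u) avoid_upd_setU1 // /nb upd_same.
rewrite -[2 * eps](E_cst I) -pEZ -!pEB; apply: ler_E => w.
apply: le_trans (row_busy_ge (rk_rank_fun (nb w) A)).
rewrite !lerD2r; apply: ler_sum => x _; rewrite ler_wpM2l ?a_law.1 //.
apply: two_or_more_mono; first exact: (load_ge0 (q_ge0 x) qm1).
by apply: (load_mono (q_ge0 x) qm1); rewrite -(setU1C u); apply: avoid_sub.
Qed.

(** Replaces the idle counts of [E_avoidable_le] by their predictions. [expRN_lip] makes the error
    linear in the deviations, which [idleN_variance] controls; [k * eps] is the cost of passing from
    [miss] to the exponential. *)
Lemma E_avoid_tilt v A : (0 < k)%N -> 0 < A ->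
  E (fun w => (v \in avoid setT w)%:R) <=
  E (fun w => expR (- (k%:R * tilt a q (fun x => load (q x) (avoid setT w)) v))) +
  (\sum_x q x v) *
    ((A + (k%:R + 2 * k%:R ^+ 2 * qm * (loss k.-1 + loss k)) / A) / 2 + k%:R * eps).
Proof.
move=> k0 A0; apply: le_trans (E_avoidable_le _ v) _.
set V := k%:R + _; set K : R := k%:R.
have K0 : 0 <= K by apply: ler0n.
pose dev x w := (idleN x w - K * a x * miss (q x) (avoid setT w)) ^+ 2.
apply: (@le_trans _ _ (E (fun w =>
    expR (- (K * tilt a q (fun x => load (q x) (avoid setT w)) v)) +
    \sum_x q x v * ((A + A^-1 * dev x w) / 2 + K * eps)))); last first.
  rewrite pED lerD2l pE_sum big_distrl; apply: ler_sum => x _ /=.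
  have /andP[q0 _] := q_ge0 x v.
  rewrite pEZ ler_wpM2l // pED E_cst lerD2r.
  have -> : E (fun w => (A + A^-1 * dev x w) / 2) = (A + A^-1 * E (dev x)) / 2.
    transitivity (E (fun w => 2^-1 * (A + A^-1 * dev x w))).
      by apply: eq_pE => w; exact: mulrC.
    by rewrite pEZ pED E_cst pEZ mulrC.
  rewrite ler_pM2r ?invr_gt0 ?ltr0n // lerD2l mulrC ler_pM2r ?invr_gt0 //.
  exact: idleN_variance.
apply: ler_E => w; set D := avoid setT w.
have idle0 x : 0 <= idleN x w by apply: sumr_ge0 => u _; apply: ler0n.
set s1 := \sum_x q x v * idleN x w.
have s10 : 0 <= s1.
  by apply: sumr_ge0 => x _; rewrite mulr_ge0 //; have /andP[] := q_ge0 x v.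
have tE : K * tilt a q (fun x => load (q x) D) v =
    \sum_x q x v * (K * a x * expR (- load (q x) D)).
  by rewrite /tilt big_distrr; apply: eq_bigr => x _ /=; ring.
have t0 : 0 <= K * tilt a q (fun x => load (q x) D) v.
  by rewrite mulr_ge0 //; apply: tilt_ge0.
apply: le_trans (expRN_lip s10 t0) _; rewrite lerD2l tE /s1 -sumrB.
apply: le_trans (ler_norm_sum _ _ _) _; apply: ler_sum => x _.
have /andP[q0 _] := q_ge0 x v; rewrite -mulrBr normrM ger0_norm // ler_wpM2l //.
have h1 := miss_le_expR (q_ge0 x) qm1 D; have h2 := miss_ge_expR (q_ge0 x) qm1 D.
have h3 := q_sqr x.
have -> : idleN x w - K * a x * expR (- load (q x) D) =
    (idleN x w - K * a x * miss (q x) D) + K * (a x * (miss (q x) D - expR (- load (q x) D))).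
  by ring.
apply: le_trans (ler_normD _ _) _; apply: lerD.
  rewrite /dev -/D; set y := _ - _.
  have e : (A + A^-1 * y ^+ 2) / 2 - `|y| = (A - `|y|) ^+ 2 / (2 * A).
    rewrite -(real_normK (num_real y)); field.
    by rewrite gt_eqF.
  by rewrite -subr_ge0 e divr_ge0 ?sqr_ge0 // mulr_ge0 // ltW.
rewrite normrM ger0_norm // ler_wpM2l // normrM (ger0_norm (a_law.1 x)).
have h4 : `|miss (q x) D - expR (- load (q x) D)| <= eps.
  by rewrite ler0_norm ?subr_le0 // opprB; lra.
by apply: le_trans (ler_piMl _ (a_le1 x)) h4.
Qed.

(** [W] has to work for every [Y] because it is applied to the random avoidable set before the
    expectation is taken. The factor [#|X| * B] comes from summing the errors of [E_avoid_tilt] over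
    all right vertices. *)
Lemma chain_rank_lower A B W : (0 < k)%N -> 0 < A ->
  (forall x, \sum_v q x v <= B) ->
  (forall Y, W <= k%:R * tilt_cst a (fun x => load (q x) Y) +
     \sum_v (1 - expR (- (k%:R * tilt a q (fun x => load (q x) Y) v)))) ->
  W - (k%:R * (2 * eps + 2 * qm * loss k) +
       #|X|%:R * B * ((A + (k%:R + 2 * k%:R ^+ 2 * qm * (loss k.-1 + loss k)) / A) / 2
                      + k%:R * eps))
  <= chain mu k (@rankF R J).
Proof.
move=> k0 A0 hB hW; set K : R := k%:R; set Err := (_ / 2 + _).
have K0 : 0 <= K by apply: ler0n.
have eps0 : 0 <= eps.
  have [x _|e] := pickP (mem (X : predArgType)).
    by apply: le_trans (q_sqr x); apply: sumr_ge0 => v _; rewrite sqr_ge0.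
  by have := a_law.2; rewrite big_pred0 // => /eqP; rewrite eq_sym oner_eq0.
have l0 := loss_ge0 k.-1; have l1 := loss_ge0 k.
have Err0 : 0 <= Err.
  rewrite addr_ge0 ?mulr_ge0 // addr_ge0 ?(ltW A0) // divr_ge0 ?(ltW A0) //.
  by rewrite addr_ge0 // !mulr_ge0 // addr_ge0.
rewrite -[in leRHS]cardsT -(@pE_chain R X J I mu setT) //.
apply: (@le_trans _ _ (E (fun w => \sum_v (1 - (v \in avoid setT w)%:R) +
    \sum_u (~~ [disjoint nb w u & avoid setT w])%:R))); last first.
  apply: ler_E => w; apply: le_trans (_ : (#|~: avoid setT w| +
     #|[set u | ~~ [disjoint nb w u & avoid setT w]]|)%:R <= _); last first.
    by rewrite ler_nat; apply: rk_ge_cover.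
  rewrite natrD; apply: lerD.
    rewrite -sum1_card natr_sum [leRHS]big_mkcond; apply: ler_sum => v _ /=.
    by rewrite in_setC; case: (v \in _); rewrite ?subrr ?subr0.
  rewrite -sum1_card natr_sum [leRHS]big_mkcond; apply: ler_sum => u _ /=.
  by rewrite inE; case: [disjoint _ & _].
rewrite pED !pE_sum.
have h1 : \sum_v E (fun w => 1 - (v \in avoid setT w)%:R) >=
    E (fun w => \sum_v (1 - expR (- (K * tilt a q (fun x => load (q x) (avoid setT w)) v))))
    - #|X|%:R * B * Err.
  rewrite pE_sum lerBlDr.
  apply: le_trans (_ : \sum_v (E (fun w => 1 - (v \in avoid setT w)%:R) +
    (\sum_x q x v) * Err) <= _).
    apply: ler_sum => v _; rewrite !pEB !E_cst.
    by have := E_avoid_tilt v k0 A0; rewrite -/K -/Err; lra.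
  rewrite big_split /= lerD2l -big_distrl ler_wpM2r // exchange_big /=.
  apply: le_trans (ler_sum _ (fun x _ => hB x)) _.
  by rewrite sumr_const mulr_natl.
have h2 : \sum_u E (fun w => (~~ [disjoint nb w u & avoid setT w])%:R) >=
    K * (E (fun w => tilt_cst a (fun x => load (q x) (avoid setT w))) - 2 * eps
    - 2 * qm * loss k).
  by rewrite /K (mulr_natl _ k) -sumr_const; apply: ler_sum => u _; apply: E_busy.
apply: le_trans (lerD h1 h2).
have h3 : W <= E (fun w => \sum_v (1 - expR (- (K * tilt a q (fun x => load (q x) (avoid setT w)) v))))
    + K * E (fun w => tilt_cst a (fun x => load (q x) (avoid setT w))).
  rewrite -pEZ -pED -[leLHS](E_cst I); apply: ler_E => w.
  by rewrite addrC; apply: hW.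
by lra.
Qed.

End MoreSlots.
End LowerBound.

(** * Averaging over the types of the right vertices *)

(** Drops are taken in consecutive pairs since the variance bound involves both [loss k.-1] and
    [loss k]. Each of the two sums telescopes to at most [N], hence [2 * N]. *)
Lemma pigeonhole_drop (R : realType) (f : nat -> R) (N : R) (m d : nat) (L : R) :
  (forall j, 0 <= f j <= N) -> 2 * N <= d%:R * L -> (0 < d)%N ->
  exists2 k, (m < k <= m + d)%N & (f k.-2 - f k.-1) + (f k.-1 - f k) <= L.
Proof.
move=> fN NL d0; apply: contrapT => H.
have {}H i : (i < d)%N -> L < (f (m + i).-1 - f (m + i)%N) + (f (m + i)%N - f (m + i).+1).
  move=> id; rewrite ltNge; apply/negP => h; apply: H; exists (m + i).+1 => //.
  by rewrite ltnS leq_addr /= -addnS leq_add2l.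
have S : forall j, (0 < j <= d)%N ->
    j%:R * L < (f m.-1 - f (m + j).-1) + (f m - f (m + j)%N).
  elim=> // -[_ _|j IH /= jd].
    by rewrite mul1r addn1 /=; have := H 0%N d0; rewrite addn0.
  have := IH (ltnW jd); have := H j.+1 jd.
  by rewrite !addnS /= -[j.+2%:R]natr1 mulrDl mul1r; lra.
have := S d; rewrite d0 leqnn => /(_ isT).
have /andP[? ?] := fN m.-1; have /andP[? ?] := fN (m + d).-1.
have /andP[? ?] := fN m; have /andP[? ?] := fN (m + d)%N.
by lra.
Qed.

Section Empirical.
Variables (R : realType) (I T : finType) (b : T -> R).
Hypothesis b_law : is_law b.
Local Notation E := (pE (fun _ : I => b)).

Lemma E_sum_coord (h : T -> R) :
  E (fun t => \sum_i h (t i)) = #|I|%:R * \sum_y b y * h y.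
Proof.
rewrite pE_sum mulr_natl -sumr_const; apply: eq_bigr => i _.
exact: pE_coord.
Qed.

Lemma E_sum_coord_sqr (h : T -> R) : \sum_y b y * h y = 0 -> (forall y, `|h y| <= 1) ->
  E (fun t => (\sum_i h (t i)) ^+ 2) <= #|I|%:R.
Proof.
move=> h0 h1.
have -> : E (fun t => (\sum_i h (t i)) ^+ 2) =
    \sum_i \sum_j E (fun t => h (t i) * h (t j)).
  under [RHS]eq_bigr => i _ do rewrite -pE_sum.
  rewrite -pE_sum; apply: eq_pE => t; rewrite expr2 big_distrl.
  by apply: eq_bigr => i _; rewrite big_distrr.
have -> : #|I|%:R = \sum_(i : I) 1 :> R by rewrite sumr_const.
apply: ler_sum => i _; rewrite (bigD1 i) //= big1 ?addr0.
  rewrite -[leRHS](@pE_cst R I T (fun=> b)); last by move=> _; apply: b_law.2.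
  apply: ler_pE => [_|t]; first exact: b_law.1.
  by rewrite -expr2 -(real_normK (num_real _)) exprn_ile1.
move=> j ji; rewrite (pE_resample1 j) ?b_law.2 //.
rewrite -[RHS](@pE_cst R I T (fun=> b)); last by move=> _; apply: b_law.2.
apply: eq_pE => t.
transitivity (h (t i) * \sum_y b y * h y); last by rewrite h0 mulr0.
rewrite big_distrr; apply: eq_bigr => y _ /=.
by rewrite upd_same upd_other 1?eq_sym // mulrCA.
Qed.

Definition dev (t : {ffun I -> T}) y : R := #|I|%:R^-1 * (\sum_i (t i == y)%:R) - b y.

Lemma E_dev y d : (0 < #|I|)%N -> 0 < d ->
  E (fun t => `|dev t y|) <= (d + d^-1 / #|I|%:R) / 2.
Proof.
move=> I0 d0; set N : R := #|I|%:R.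
have N0 : 0 < N by rewrite ltr0n.
have by0 := b_law.1 y.
have by1 : b y <= 1.
  by rewrite -b_law.2 (bigD1 y) //= lerDl; apply: sumr_ge0 => u _; apply: b_law.1.
pose h u : R := (u == y)%:R - b y.
have devE t : dev t y = N^-1 * \sum_i h (t i).
  rewrite /dev /h sumrB sumr_const -(mulr_natl (b y)) mulrBr mulrA mulVf ?mul1r //.
  by rewrite gt_eqF.
have hh : E (fun t => (\sum_i h (t i)) ^+ 2) <= N.
  apply: E_sum_coord_sqr => [|u].
    rewrite /h; under eq_bigr => u _ do rewrite mulrBr.
    rewrite sumrB -big_distrl /= b_law.2 mul1r.
    under eq_bigr => u _ do rewrite mulrC.
    by rewrite sum_point subrr.
  by rewrite /h ler_norml; case: eqP => _ /=; apply/andP; split; lra.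
apply: (@le_trans _ _ (E (fun t => 2^-1 * (d + d^-1 * (N^-1 ^+ 2 * (\sum_i h (t i)) ^+ 2))))).
  apply: ler_pE => [_|t]; first exact: b_law.1.
  rewrite -exprMn -devE -subr_ge0; set y' := dev t y.
  have -> : 2^-1 * (d + d^-1 * y' ^+ 2) - `|y'| = (d - `|y'|) ^+ 2 / (2 * d).
    rewrite -(real_normK (num_real y')); field.
    by rewrite gt_eqF.
  by rewrite divr_ge0 ?sqr_ge0 // mulr_ge0 // ltW.
rewrite pEZ pED !pEZ pE_cst; last by move=> _; apply: b_law.2.
rewrite mulrC ler_pM2r ?invr_gt0 ?ltr0n // lerD2l ler_wpM2l ?invr_ge0 ?(ltW d0) //.
apply: (@le_trans _ _ (N^-1 ^+ 2 * N)); first by rewrite ler_wpM2l ?sqr_ge0.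
by rewrite expr2 -mulrA mulVf ?mulr1 // gt_eqF.
Qed.

End Empirical.

(** * Bounds on the matching rate at a fixed size *)

Section Rate.
Variables (R : realType) (X T : finType) (x0 : X) (a : X -> R) (b : T -> R).
Variables (c : X -> T -> R) (K : R).
Hypothesis a_law : is_law a.
Hypothesis b_law : is_law b.
Hypothesis c_ge0 : forall x y, 0 <= c x y <= K.
Hypothesis K0 : 0 <= K.

Definition edge n (t : {ffun 'I_n -> T}) x j : R := Num.min 1 (c x (t j) / n%:R).

Definition rate n : R :=
  pE (fun _ : 'I_n => b) (fun t => chain (row_law a (edge t)) n (@rankF R 'I_n)) / n%:R.

(** [n * tilt] at a right vertex of type [y], that is, the mean number of pendant edges there. *)
Definition pull (z : X -> R) y : R := \sum_x a x * (expR (- z x) * c x y).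

Definition potential (z : X -> R) : R :=
  tilt_cst a z + \sum_y b y * (1 - expR (- pull z y)).

Section FixedSize.
Variable n : nat.
Hypothesis n_gt0 : (0 < n)%N.
Hypothesis n_ge : 2 * K <= n%:R.
Local Notation N := (n%:R : R).
Local Notation qm := (K / N).

Let N0 : 0 < N. Proof. by rewrite ltr0n. Qed.

Let qm0 : 0 <= qm. Proof. by rewrite divr_ge0 // ltW. Qed.

Let qm_half : 2 * qm <= 1. Proof. by rewrite mulrA ler_pdivrMr // mul1r. Qed.

Let Nqm : N * qm = K. Proof. by rewrite mulrC divfK // gt_eqF. Qed.

Lemma edgeE (t : {ffun 'I_n -> T}) x j : edge t x j = c x (t j) / N.
Proof.
rewrite /edge; apply/min_idPr; have /andP[h1 h2] := c_ge0 x (t j).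
by rewrite ler_pdivrMr // mul1r; move: n_ge K0 h2; lra.
Qed.

Lemma edge_ge0 (t : {ffun 'I_n -> T}) x j : 0 <= edge t x j <= qm.
Proof.
have /andP[h1 h2] := c_ge0 x (t j).
by rewrite edgeE divr_ge0 ?(ltW N0) //= ler_pM2r ?invr_gt0.
Qed.

Let edge01 (t : {ffun 'I_n -> T}) x j : 0 <= edge t x j <= 1.
Proof.
have /andP[-> h] := edge_ge0 t x j; apply: le_trans h _.
by move: qm0 qm_half; lra.
Qed.

Lemma edge_sqr (t : {ffun 'I_n -> T}) x : \sum_j edge t x j ^+ 2 <= K * qm.
Proof.
apply: (@le_trans _ _ (\sum_(j < n) qm ^+ 2)).
  apply: ler_sum => j _; have /andP[h1 h2] := edge_ge0 t x j.
  by rewrite lerXn2r ?nnegrE.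
by rewrite sumr_const card_ord -(mulr_natl (qm ^+ 2)) expr2 mulrA Nqm.
Qed.

Lemma pull_ge0 z y : 0 <= pull z y.
Proof.
apply: sumr_ge0 => x _; have /andP[h1 h2] := c_ge0 x y.
by rewrite mulr_ge0 ?a_law.1 // mulr_ge0 ?expR_ge0.
Qed.

Lemma pull_le z y : (forall x, 0 <= z x) -> pull z y <= K.
Proof.
move=> z0; have -> : K = \sum_x a x * K by rewrite -big_distrl /= a_law.2 mul1r.
apply: ler_sum => x _; have /andP[h1 h2] := c_ge0 x y.
rewrite ler_wpM2l ?a_law.1 // -[leRHS]mul1r ler_pM ?expR_ge0 //.
by rewrite -expR0 ler_expR oppr_le0.
Qed.

Lemma tilt_edge (t : {ffun 'I_n -> T}) z j : tilt a (edge t) z j = pull z (t j) / N.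
Proof.
by rewrite /tilt /pull big_distrl; apply: eq_bigr => x _ /=; rewrite edgeE !mulrA.
Qed.

Lemma rate_upper z d : (forall x, 0 <= z x) -> 0 < d ->
  rate n <= potential z + d / 2 + (2 * K ^+ 2 + d^-1 / 2) / N.
Proof.
move=> z0 d0; have dN : 0 < d * N by rewrite mulr_gt0.
have H (t : {ffun 'I_n -> T}) : chain (row_law a (edge t)) n (@rankF R 'I_n) <=
    \sum_j (tilt_cst a z + (1 - expR (- pull z (t j)))) + (2 * K ^+ 2 + (d * N + d^-1) / 2).
  have := chain_rank_upper x0 a_law (edge01 t) z n dN (edge_sqr t).
  have -> : \sum_j (tilt_cst a z + (1 - expR (- pull z (t j)))) =
      N * tilt_cst a z + \sum_j (1 - expR (- pull z (t j))).
    by rewrite big_split /= sumr_const card_ord mulr_natl.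
  have -> : \sum_v (1 - expR (- (N * tilt a (edge t) z v))) =
      \sum_j (1 - expR (- pull z (t j))).
    by apply: eq_bigr => j _; rewrite tilt_edge mulrC divfK // gt_eqF.
  have h1 : N * (\sum_v tilt a (edge t) z v ^+ 2) <= K ^+ 2.
    apply: (@le_trans _ _ (N * \sum_(j < n) qm ^+ 2)).
      rewrite ler_wpM2l ?(ltW N0) //; apply: ler_sum => j _; rewrite tilt_edge.
      rewrite lerXn2r ?nnegrE ?divr_ge0 ?pull_ge0 ?(ltW N0) //.
      by rewrite ler_pM2r ?invr_gt0 // pull_le.
    rewrite sumr_const card_ord -(mulr_natl (qm ^+ 2)) mulrA -expr2 -exprMn Nqm //.
  have h2 : N * (K * qm) = K ^+ 2 by rewrite mulrCA Nqm expr2.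
  have h3 : N / (d * N) = d^-1.
    by field; rewrite !gt_eqF.
  by rewrite h3 mulrDr h2; lra.
rewrite /rate ler_pdivrMr //.
apply: le_trans (ler_pE (fun _ => b_law.1) H) _.
rewrite pED pE_cst; last by move=> _; apply: b_law.2.
rewrite (E_sum_coord _ b_law (fun y => tilt_cst a z + (1 - expR (- pull z y)))) card_ord.
have -> : \sum_y b y * (tilt_cst a z + (1 - expR (- pull z y))) = potential z.
  under eq_bigr => y _ do rewrite mulrDr.
  by rewrite big_split -big_distrl /= b_law.2 mul1r.
rewrite le_eqVlt; apply/orP; left; apply/eqP; field.
by rewrite !gt_eqF.
Qed.


Variable g : R.
Hypothesis g_le : forall z, (forall x, 0 <= z x <= \sum_y c x y * b y) -> g <= potential z.

Let g_le1 : g <= 1.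
Proof.
have h := g_le (z := fun=> 0); apply: le_trans (h _) _.
  move=> x; rewrite lexx /=; apply: sumr_ge0 => y _.
  by rewrite mulr_ge0 ?b_law.1 //; have /andP[] := c_ge0 x y.
rewrite /potential /tilt_cst big1 ?add0r => [|x _]; last first.
  by rewrite /two_or_more oppr0 expR0 addr0 mulr1 subrr mulr0.
rewrite -[leRHS]b_law.2; apply: ler_sum => y _; rewrite ler_piMr ?b_law.1 //.
Qed.

Definition discrepancy (t : {ffun 'I_n -> T}) : R := \sum_y `|dev b t y|.

Let discrepancy_ge0 t : 0 <= discrepancy t.
Proof. by apply: sumr_ge0. Qed.

Lemma sum_types (t : {ffun 'I_n -> T}) (h : T -> R) :
  \sum_j h (t j) = N * \sum_y (b y + dev b t y) * h y.
Proof.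
transitivity (\sum_j \sum_y (t j == y)%:R * h y).
  apply: eq_bigr => j _; rewrite -[LHS](sum_point (t j)).
  by apply: eq_bigr => y _; rewrite eq_sym.
rewrite exchange_big big_distrr; apply: eq_bigr => y _ /=.
rewrite -big_distrl /dev card_ord /= addrC subrK mulrA mulrA mulfV ?mul1r //.
by rewrite gt_eqF.
Qed.

(** [z] may leave the box of [g_le] by [d]. Clamping it back can only lower [tilt_cst], and raises
    each [pull] by at most [K * d], which is the whole loss. *)
Lemma potential_min z d : 0 <= d ->
  (forall x, 0 <= z x <= \sum_y c x y * b y + d) -> g - K * d <= potential z.
Proof.
move=> d0 hz; pose z' x := Num.min (z x) (\sum_y c x y * b y).
have hz' x : 0 <= z' x <= \sum_y c x y * b y.
  rewrite /z' ge_min lexx orbT andbT le_min; have /andP[-> _] := hz x.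
  apply: sumr_ge0 => y _; rewrite mulr_ge0 ?b_law.1 //.
  by have /andP[] := c_ge0 x y.
have zz' x : z' x <= z x by rewrite /z' ge_min lexx.
have zd x : z x - z' x <= d.
  have /andP[h0 h1] := hz x; rewrite /z' minEle; case: ifP => _; lra.
have h1 : tilt_cst a z' <= tilt_cst a z.
  apply: ler_sum => x _; rewrite ler_wpM2l ?a_law.1 // two_or_more_mono //.
  by have /andP[] := hz' x.
have h2 y : pull z' y - pull z y <= K * d.
  rewrite /pull -sumrB; have -> : K * d = \sum_x a x * (K * d).
    by rewrite -big_distrl /= a_law.2 mul1r.
  apply: ler_sum => x _; rewrite -mulrBr ler_wpM2l ?a_law.1 // -mulrBl mulrC.
  have /andP[k1 k2] := c_ge0 x y; have /andP[k3 _] := hz' x; have /andP[k4 _] := hz x.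
  have k5 := expRN_lip k3 k4; rewrite distrC ger0_norm ?subr_ge0 // in k5.
  have k6 : 0 <= expR (- z' x) - expR (- z x) by rewrite subr_ge0 ler_expR lerN2.
  by rewrite ler_pM //; have := zd x; lra.
have h3 y : pull z y <= pull z' y.
  apply: ler_sum => x _; have /andP[k1 k2] := c_ge0 x y.
  by rewrite ler_wpM2l ?a_law.1 // ler_wpM2r // ler_expR lerN2.
have h4 : \sum_y b y * (1 - expR (- pull z' y)) - K * d <=
    \sum_y b y * (1 - expR (- pull z y)).
  have -> : K * d = \sum_y b y * (K * d) by rewrite -big_distrl /= b_law.2 mul1r.
  rewrite -sumrB; apply: ler_sum => y _; rewrite -mulrBr ler_wpM2l ?b_law.1 //.
  have := expRN_lip (pull_ge0 z y) (pull_ge0 z' y).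
  by rewrite distrC ger0_norm ?subr_ge0 //; have := h2 y; lra.
rewrite lerBlDr; apply: le_trans (g_le hz') _.
by rewrite /potential -addrA lerD // -lerBlDr.
Qed.

(** Origin of [K ^+ 2 + 1]: a load may exceed the box by [K * discrepancy t], which [potential_min]
    multiplies by [K], and passing between empirical type frequencies and [b] costs one more
    [discrepancy t]. *)
Lemma potential_types (t : {ffun 'I_n -> T}) (Y : {set 'I_n}) :
  N * (g - (K ^+ 2 + 1) * discrepancy t) <=
  N * tilt_cst a (fun x => load (edge t x) Y) +
  \sum_j (1 - expR (- pull (fun x => load (edge t x) Y) (t j))).
Proof.
set z := (fun x => load (edge t x) Y); have D0 := discrepancy_ge0 t.
have hz x : 0 <= z x <= \sum_y c x y * b y + K * discrepancy t.
  rewrite (load_ge0 (edge_ge0 t x)) //=; last by move: qm0 qm_half; lra.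
  apply: (@le_trans _ _ (\sum_j edge t x j)).
    rewrite [leRHS](bigID (mem Y)) /= lerDl; apply: sumr_ge0 => j _.
    by have /andP[] := edge_ge0 t x j.
  rewrite (eq_bigr (fun j => c x (t j) / N)); last by move=> j _; apply: edgeE.
  rewrite (sum_types t (fun y => c x y / N)) big_distrr /discrepancy big_distrr -big_split.
  apply: ler_sum => y _ /=; have /andP[k1 k2] := c_ge0 x y.
  have -> : N * ((b y + dev b t y) * (c x y / N)) = c x y * b y + c x y * dev b t y.
    by field; rewrite gt_eqF.
  rewrite lerD2l; apply: le_trans (ler_wpM2l k1 (ler_norm _)) _.
  by rewrite ler_wpM2r.
have h := potential_min (mulr_ge0 K0 D0) hz.
rewrite (sum_types t (fun y => 1 - expR (- pull z y))) -mulrDr ler_wpM2l ?(ltW N0) //.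
have h2 : \sum_y b y * (1 - expR (- pull z y)) - discrepancy t <=
    \sum_y (b y + dev b t y) * (1 - expR (- pull z y)).
  rewrite -sumrB; apply: ler_sum => y _; rewrite mulrDl lerD2l.
  have k1 : 0 <= 1 - expR (- pull z y) by rewrite subr_ge0 -expR0 ler_expR oppr_le0 pull_ge0.
  have k2 : 1 - expR (- pull z y) <= 1 by rewrite lerBlDr lerDl expR_ge0.
  have k3 := ler_norm (- dev b t y); rewrite normrN in k3.
  have k4 : 0 <= (`|dev b t y| + dev b t y) * (1 - expR (- pull z y)).
    by rewrite mulr_ge0 //; lra.
  have k5 : 0 <= `|dev b t y| * (1 - (1 - expR (- pull z y))).
    by rewrite mulr_ge0 // subr_ge0.
  by lra.
by move: h; rewrite /potential; lra.
Qed.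

Lemma good_size (p : X * {set 'I_n} -> R) d : is_law p -> 0 < d <= 1 -> 1 <= d * N ->
  exists k, [/\ (0 < k <= n)%N, (1 - d) * N <= k%:R &
    (chain p k.-2 (@avoidF R 'I_n) - chain p k.-1 (@avoidF R 'I_n)) +
    (chain p k.-1 (@avoidF R 'I_n) - chain p k (@avoidF R 'I_n)) <= 4 / d].
Proof.
move=> lp /andP[d0 d1] dN; pose e := Num.truncn (d * N).
have dN0 : 0 <= d * N by rewrite mulr_ge0 ?(ltW N0) ?(ltW d0).
have e1 : e%:R <= d * N by rewrite truncn_le.
have e2 : d * N < e.+1%:R by apply: truncnS_gt.
have e0 : (0 < e)%N by rewrite truncn_gt_nat.
have en : (e <= n)%N.
  by rewrite -(ler_nat R); apply: le_trans e1 _; rewrite ler_piMl ?(ltW N0).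
have fN j : 0 <= chain p j (@avoidF R 'I_n) <= N.
  apply/andP; split.
    rewrite -[0](@iter_stepE_cst R X 'I_n p j 0 (fun=> 0%N) lp).
    by apply: chain_le => // rho; apply: ler0n.
  rewrite -[leRHS](@iter_stepE_cst R X 'I_n p j N (fun=> 0%N) lp).
  by apply: chain_le => // rho; rewrite /avoidF ler_nat -[leqRHS]card_ord max_card.
(* The window consists of the last [e] sizes, [e] being the integer part of [d * N]. From [1 <= e]
   and [d * N < e + 1] follows [d * N <= 2 * e], that is [2 * N <= e * (4 / d)]. *)
have [|k /andP[k1 k2] hk] := @pigeonhole_drop R _ N (n - e) e (4 / d) fN _ e0.
  have e3 : 1 <= e%:R :> R by rewrite ler1n.
  rewrite mulrA ler_pdivlMr //; rewrite -natr1 in e2; lra.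
rewrite subnK // in k2; exists k; split => //.
  by rewrite (leq_ltn_trans _ k1).
have : (n - e)%:R <= k%:R :> R by rewrite ler_nat ltnW.
by rewrite natrB //; lra.
Qed.

Lemma rate_lower d : 0 < d <= 1 -> 1 <= d * N ->
  g - (1 + (K ^+ 2 + 1) * #|T|%:R / 2 + #|X|%:R * K / 2) * d
    - ((K ^+ 2 + 1) * #|T|%:R * d^-1 / 2 + (2 * K ^+ 2 + 8 * K / d) +
       #|X|%:R * K * ((1 + 8 * K / d) / d / 2 + K ^+ 2)) / N <= rate n.
Proof.
move=> d01 dN; have /andP[d0 d1] := d01.
pose Err := (2 * K ^+ 2 + 8 * K / d) +
   #|X|%:R * K * (d * N / 2 + (1 + 8 * K / d) / d / 2 + K ^+ 2).
have H (t : {ffun 'I_n -> T}) : N * (g - d - (K ^+ 2 + 1) * discrepancy t) - Err <=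
    chain (row_law a (edge t)) n (@rankF R 'I_n).
  have lp := row_law_law a_law (edge01 t).
  have [k [/andP[k0 kn] kN hk]] := good_size lp d01 dN.
  (* Only [k] rows are kept, where the loss is under control; the others cannot lower the rank. *)
  apply: le_trans (chain_rank_mono lp kn).
  pose l : R := k%:R / N.
  have kR : k%:R <= N by rewrite ler_nat.
  have k0R : 0 <= k%:R :> R by apply: ler0n.
  have l0 : 0 <= l by rewrite divr_ge0 // ltW.
  have l1 : l <= 1 by rewrite ler_pdivrMr // mul1r.
  have ld : 1 - d <= l by rewrite ler_pdivlMr.
  have lN : l * N = k%:R by rewrite divfK // gt_eqF.
  have l01 : 0 <= l <= 1 by rewrite l0 l1.
  have A0 : 0 < d * N by rewrite mulr_gt0.
  have hB x : \sum_v edge t x v <= K.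
    apply: (@le_trans _ _ (\sum_(v < n) qm)).
      by apply: ler_sum => v _; have /andP[] := edge_ge0 t x v.
    by rewrite sumr_const card_ord -(mulr_natl qm) Nqm.
  have hW (Y : {set 'I_n}) : l * (N * (g - (K ^+ 2 + 1) * discrepancy t)) <=
      #|'I_k|%:R * tilt_cst a (fun x => load (edge t x) Y) +
      \sum_v (1 - expR (- (#|'I_k|%:R * tilt a (edge t) (fun x => load (edge t x) Y) v))).
    rewrite card_ord; apply: le_trans (ler_wpM2l l0 (potential_types t Y)) _.
    rewrite mulrDr mulrA lN lerD2l big_distrr; apply: ler_sum => v _ /=.
    apply: le_trans (one_sub_expRN_scale l01 (pull_ge0 _ _)) _.
    by rewrite tilt_edge /l mulrAC mulrA.
  have := chain_rank_lower a_law (edge_ge0 t) qm0 qm_half (edge_sqr t) _ A0 hB hW.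
  rewrite card_ord k0 => /(_ isT).
  have L0 := loss_ge0 a_law (edge_ge0 t) qm0 qm_half k.-1.
  have L1 := loss_ge0 a_law (edge_ge0 t) qm0 qm_half k.
  have hk' : loss a (edge t) k.-1 + loss a (edge t) k <= 4 / d by exact: hk.
  apply: le_trans; set L := loss _ _ k in L1 hk' *; set L' := loss _ _ _ in L0 hk' *.
  have d4 : 0 <= 4 / d by rewrite divr_ge0 // ltW.
  have c1 : k%:R * (2 * (K * qm) + 2 * qm * L) <= 2 * K ^+ 2 + 8 * K / d.
    apply: (@le_trans _ _ (N * (2 * (K * qm) + 2 * qm * (4 / d)))).
      apply: ler_pM => //; first by rewrite addr_ge0 // !mulr_ge0.
      by rewrite lerD2l ler_wpM2l ?mulr_ge0 //; lra.
    rewrite le_eqVlt; apply/orP; left; apply/eqP; field.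
    by rewrite !gt_eqF.
  have c2 : (k%:R + 2 * k%:R ^+ 2 * qm * (L' + L)) / (d * N) <= (1 + 8 * K / d) / d.
    rewrite ler_pdivrMr //.
    have -> : (1 + 8 * K / d) / d * (d * N) = N + 2 * N ^+ 2 * qm * (4 / d).
      by field; rewrite !gt_eqF.
    apply: lerD => //; apply: ler_pM => //; first by rewrite !mulr_ge0 ?sqr_ge0.
      by rewrite addr_ge0.
    by rewrite ler_wpM2r // ler_wpM2l // lerXn2r ?nnegrE ?(ltW N0).
  have c3 : k%:R * (K * qm) <= K ^+ 2.
    have -> : K ^+ 2 = N * (K * qm) by rewrite mulrCA Nqm expr2.
    by rewrite ler_wpM2r ?mulr_ge0.
  have XK0 : 0 <= #|X|%:R * K by rewrite mulr_ge0.
  apply: lerB; last first.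
    apply: lerD => //; rewrite ler_wpM2l //; lra.
  have c4 : g - d - (K ^+ 2 + 1) * discrepancy t <= l * (g - (K ^+ 2 + 1) * discrepancy t).
    have D0 : 0 <= (K ^+ 2 + 1) * discrepancy t by rewrite mulr_ge0 // addr_ge0 ?sqr_ge0.
    set S := (_ + 1) * _ in D0 *.
    have j1 : 0 <= (1 - l) * (1 - g) by rewrite mulr_ge0 // subr_ge0.
    have j2 : 0 <= (1 - l) * S by rewrite mulr_ge0 // subr_ge0.
    by lra.
  by rewrite mulrCA ler_wpM2l // ltW.
rewrite /rate ler_pdivlMr //.
apply: le_trans (ler_pE (fun _ => b_law.1) H).
rewrite pEB (pE_cst Err); last by move=> _; apply: b_law.2.
rewrite pEZ pEB pE_cst; last by move=> _; apply: b_law.2.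
rewrite pEZ.
have hD : pE (fun=> b) discrepancy <= #|T|%:R * ((d + d^-1 / N) / 2).
  rewrite /discrepancy pE_sum mulr_natl -sumr_const; apply: ler_sum => y _.
  have := E_dev b_law y (I := 'I_n) _ d0; rewrite card_ord => h; exact: h n_gt0.
set PD := pE _ discrepancy in hD *.
have hD' : (K ^+ 2 + 1) * PD <= (K ^+ 2 + 1) * (#|T|%:R * ((d + d^-1 / N) / 2)).
  by rewrite ler_wpM2l // addr_ge0 ?sqr_ge0.
apply: (@le_trans _ _ (N * (g - d - (K ^+ 2 + 1) * (#|T|%:R * ((d + d^-1 / N) / 2))) - Err)).
  rewrite le_eqVlt; apply/orP; left; apply/eqP; rewrite /Err; field.
  by rewrite !gt_eqF.
by rewrite lerD2r ler_wpM2l ?(ltW N0) // lerD2l lerN2.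
Qed.

End FixedSize.
End Rate.

Section RateLimit.
Variables (R : realType) (X T : finType) (x0 : X) (a : X -> R) (b : T -> R).
Variables (c : X -> T -> R) (K : R).
Hypothesis a_law : is_law a.
Hypothesis b_law : is_law b.
Hypothesis c_ge0 : forall x y, 0 <= c x y <= K.
Hypothesis K0 : 0 <= K.

Lemma rate_cvg (z : X -> R) : (forall x, 0 <= z x) ->
  (forall z', (forall x, 0 <= z' x <= \sum_y c x y * b y) ->
    potential a b c z <= potential a b c z') ->
  (rate a b c @ \oo --> potential a b c z)%classic.
Proof.
move=> z0 zmin; apply/cvgrPdist_lt => e e0; set g := potential a b c z.
(* The coefficient of [d] in [rate_lower]; being at least 1, it also covers the [d / 2] of
   [rate_upper]. *)
pose C : R := 1 + (K ^+ 2 + 1) * #|T|%:R / 2 + #|X|%:R * K / 2.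
have C1 : 1 <= C.
  by rewrite /C -addrA lerDl addr_ge0 // ?divr_ge0 ?mulr_ge0 ?addr_ge0 ?sqr_ge0.
have C0 : 0 < C by lra.
pose d := Num.min 1 (e / (2 * C)).
have d0 : 0 < d by rewrite lt_min ltr01 divr_gt0 // mulr_gt0.
have d1 : d <= 1 by rewrite ge_min lexx.
have dC : C * d <= e / 2.
  have : d <= e / (2 * C) by rewrite ge_min lexx orbT.
  rewrite ler_pdivlMr ?mulr_gt0 //; lra.
pose D1 := 2 * K ^+ 2 + d^-1 / 2.
pose D2 := (K ^+ 2 + 1) * #|T|%:R * d^-1 / 2 + (2 * K ^+ 2 + 8 * K / d) +
       #|X|%:R * K * ((1 + 8 * K / d) / d / 2 + K ^+ 2).
near=> n.
have n1 : 1 <= n%:R :> R by near: n; apply: nbhs_infty_ger.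
have n0 : (0 < n)%N by rewrite -(ltr_nat R); apply: lt_le_trans n1.
have N0 : 0 < n%:R :> R by rewrite ltr0n.
have nK : 2 * K <= n%:R by near: n; apply: nbhs_infty_ger.
have nd : 1 <= d * n%:R.
  rewrite -ler_pdivrMl // mulr1; near: n; exact: nbhs_infty_ger.
have nD1 : D1 / n%:R < e / 2.
  rewrite ltr_pdivrMr // -ltr_pdivrMl ?divr_gt0 //.
  apply: (@lt_le_trans _ _ ((e / 2)^-1 * D1 + 1)); first by rewrite ltrDl.
  near: n; exact: nbhs_infty_ger.
have nD2 : D2 / n%:R < e / 2.
  rewrite ltr_pdivrMr // -ltr_pdivrMl ?divr_gt0 //.
  apply: (@lt_le_trans _ _ ((e / 2)^-1 * D2 + 1)); first by rewrite ltrDl.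
  near: n; exact: nbhs_infty_ger.
have hu := rate_upper x0 a_law b_law c_ge0 K0 n0 nK z0 d0.
have d01 : 0 < d <= 1 by rewrite d0.
have hl := rate_lower a_law b_law c_ge0 K0 n0 nK zmin d01 nd.
rewrite -/C -/D2 -/g in hl; rewrite -/D1 -/g in hu.
have dC' : d <= C * d by rewrite ler_peMl // ltW.
by rewrite ltr_distlC; apply/andP; split; lra.
Unshelve. all: by end_near.
Qed.

End RateLimit.

(** * From the random graph to independent rows *)

Lemma max_matchingE n (G : bigraph n) :
  max_matching G = rk (fun i => [set j | (i, j) \in G]) setT setT.
Proof.
apply: eq_bigl => M; apply/idP/matching_inP => [/andP[/fintype.subsetP MG /forallP h]|[h1 h2]].
  split=> [e /MG eG|e f eM fM ef]; first by rewrite !inE -surjective_pairing.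
  have /implyP/(_ eM)/forallP/(_ f)/implyP/(_ fM)/implyP/(_ ef) := h e.
  by move/eqP.
apply/andP; split.
  by apply/fintype.subsetP => e /h1[_ _]; rewrite inE -surjective_pairing.
apply/forallP=> e; apply/implyP=> eM; apply/forallP=> f; apply/implyP=> fM.
by apply/implyP=> ef; apply/eqP; apply: h2.
Qed.

Lemma type_prob_law (R : realType) (b : R) : 0 <= b <= 1 -> is_law (type_prob b).
Proof.
move=> /andP[b0 b1]; split=> [x|]; first by rewrite /type_prob; case: eqP; rewrite ?subr_ge0.
by rewrite big_ord_recl big_ord1 /type_prob /= subrK.
Qed.

(** Given the types on the right, supply nodes paired with their neighbourhoods are independent rows
    of law [row_law]; the bijection [h] turns left types and a graph into such a family of rows. *)
Lemma matching_rateE (R : realType) (bL bR : R) (C : 'M[R]_2) n : 0 <= bL <= 1 ->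
  (forall x y, 0 <= edge_prob C n x y) ->
  matching_rate bL bR C n = rate (type_prob bL) (type_prob bR) (fun x y => C x y) n.
Proof.
move=> hL hC; rewrite /matching_rate /rate; congr (_ / _).
rewrite /expected_matching exchange_big; apply: eq_bigr => tR _ /=.
set mu := row_law _ _.
have mu_law : is_law mu.
  apply: row_law_law; first exact: type_prob_law.
  by move=> x v; rewrite hC ge_min lexx.
have -> : chain mu n (@rankF R 'I_n) =
    pE (fun _ : 'I_n => mu) (fun w => rankF R (rk (nb w) setT)).
  by rewrite (@pE_chain R _ _ 'I_n mu setT) // cardsT card_ord.
rewrite /pE big_distrr /= pair_big /=.
pose h (p : {ffun 'I_n -> 'I_2} * bigraph n) : {ffun 'I_n -> 'I_2 * {set 'I_n}} :=
  [ffun i => (p.1 i, [set j | (i, j) \in p.2])].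
pose h' (w : {ffun 'I_n -> 'I_2 * {set 'I_n}}) : {ffun 'I_n -> 'I_2} * bigraph n :=
  ([ffun i => (w i).1], [set e | e.2 \in (w e.1).2]).
have hK : cancel h h'.
  move=> [t G]; congr pair; first by apply/ffunP=> i; rewrite !ffunE.
  by apply/setP=> -[i j]; rewrite inE ffunE inE.
have hK' : cancel h' h.
  move=> w; apply/ffunP=> i; rewrite !ffunE /=; case E: (w i) => [x S] /=.
  by congr pair; apply/setP=> j; rewrite !inE E.
rewrite [RHS](reindex h) /=; last by exists h' => w _; [apply: hK | apply: hK'].
apply: eq_bigr => -[tL G] _ /=.
have -> : rankF R (rk (nb (h (tL, G))) setT) = (max_matching G)%:R :> R.
  rewrite /rankF max_matchingE; congr (_%:R); apply: rk_eq => i _.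
  by rewrite /nb ffunE.
rewrite mulrA; congr (_ * _); rewrite /graph_prob mulrAC mulrC; congr (_ * _).
rewrite [X in _ * X](_ : _ = \prod_i \prod_j
    (if (i, j) \in G then edge_prob C n (tL i) (tR j)
     else 1 - edge_prob C n (tL i) (tR j))); last by rewrite pair_big; apply: eq_bigr => -[].
rewrite -big_split; apply: eq_bigr => i _ /=.
rewrite /mu /row_law ffunE /=; congr (_ * _); apply: eq_bigr => j _.
by rewrite inE.
Qed.

(** * The two-sided flexibility design *)

Section Flexibility.
Variables (R : realType) (B alpha alphaf : R).
Hypothesis hB : 0 < B <= 1.
Hypothesis halpha : 0 <= alpha.
Hypothesis halphaf : alpha <= alphaf.

Local Notation C := (flex_mx alpha alphaf).
Local Notation a := (type_prob (B / 2)).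

Lemma flex_mx_ge0 x y : 0 <= C x y <= 2 * alphaf.
Proof.
have h1 := halpha; have h2 := halphaf.
rewrite mxE; case: x => -[|[|//]] /= _; case: y => -[|[|//]] /= _;
  by apply/andP; split; lra.
Qed.

Definition exponents (t1 t2 : R) (x : 'I_2) : R :=
  if x == 0 then M1 B alpha alphaf * t1 else M2 B alpha alphaf * t2.

Lemma potential_flex t1 t2 :
  potential a a (fun x y => C x y) (exponents t1 t2) = 1 - F_TS B alpha alphaf t1 t2.
Proof.
rewrite /potential /tilt_cst /pull !big_ord_recl !big_ord0 /= !addr0.
rewrite /two_or_more /exponents /type_prob /= /F_TS !mxE /=.
set e1 := expR (- (_ * t1)); set e2 := expR (- (_ * t2)).
rewrite [X in expR X](_ : _ = - (2 * alpha * (1 - B / 2) * e1) - (alpha + alphaf) * (B / 2) * e2).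
  set u := expR _.
  rewrite [X in expR X](_ : _ = - ((alpha + alphaf) * (1 - B / 2) * e1) - alphaf * B * e2).
    by set v := expR _; ring.
  by field.
by field.
Qed.

(** [M1] and [M2] are the mean degrees of the two left types, so [t1] and [t2] in the unit interval
    parametrise the box of [rate_cvg]. *)
Lemma load_max (x : 'I_2) : \sum_y C x y * a y = exponents 1 1 x.
Proof.
rewrite !big_ord_recl big_ord0 !mxE /exponents /type_prob /=.
by case: x => -[|[|//]] /= i; rewrite /M1 /M2 /=; field.
Qed.

Lemma exponents_ge0 x : 0 <= exponents 1 1 x.
Proof.
rewrite -load_max; apply: sumr_ge0 => y _; have /andP[h _] := flex_mx_ge0 x y.
rewrite mulr_ge0 // /type_prob; case: ifP => _; move: hB => /andP[]; lra.
Qed.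

Lemma exponents_cover (z : 'I_2 -> R) : (forall x, 0 <= z x <= exponents 1 1 x) ->
  exists t1 t2, [/\ 0 <= t1 <= 1, 0 <= t2 <= 1 & z = exponents t1 t2].
Proof.
move=> hz.
have H (M y : R) : 0 <= y <= M * 1 -> exists2 t, 0 <= t <= 1 & y = M * t.
  rewrite mulr1 => /andP[y0 yM]; have [M0|M0] := eqVneq M 0.
    exists 0; first by rewrite lexx ler01.
    by rewrite mulr0; apply/eqP; rewrite eq_le y0 andbT -M0.
  have Mp : 0 < M by rewrite lt_neqAle eq_sym M0 (le_trans y0).
  exists (y / M); last by rewrite mulrC divfK.
  by rewrite divr_ge0 ?(ltW Mp) //= ler_pdivrMr // mul1r.
have [t1 h1 e1] := H _ _ (hz 0); have [t2 h2 e2] := H _ _ (hz 1).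
exists t1, t2; split=> //; apply: funext => x.
have [->|] := eqVneq x 0; first by rewrite e1.
by case: x => -[//|[|//]] i _; rewrite [Ordinal i](_ : _ = 1) ?e2 //; apply: val_inj.
Qed.

Lemma continuous_F_TS : continuous (fun t : R * R => F_TS B alpha alphaf t.1 t.2).
Proof.
move=> t; rewrite /F_TS.
have cM (k : R) (f : R * R -> R) (l : R) : (f @ t --> l)%classic ->
    ((fun s => k * f s) @ t --> k * l)%classic.
  by move=> h; apply: cvgM => //; exact: cvg_cst.
have cE (f : R * R -> R) (l : R) : (f @ t --> l)%classic ->
    ((fun s => expR (f s)) @ t --> expR l)%classic.
  by move=> h; apply: (cvg_comp _ _ h); exact: continuous_expR.
have c1 (k : R) : ((fun s : R * R => k * s.1) @ t --> k * t.1)%classic.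
  by apply: cM; exact: cvg_fst.
have c2 (k : R) : ((fun s : R * R => k * s.2) @ t --> k * t.2)%classic.
  by apply: cM; exact: cvg_snd.
have e1 (k : R) : ((fun s : R * R => expR (- (k * s.1))) @ t --> expR (- (k * t.1)))%classic.
  by apply: cE; apply: cvgN; exact: c1.
have e2 (k : R) : ((fun s : R * R => expR (- (k * s.2))) @ t --> expR (- (k * t.2)))%classic.
  by apply: cE; apply: cvgN; exact: c2.
apply: cvgB; last exact: cvg_cst.
apply: cvgD; last first.
  apply: cvgM; first exact/cM/e2.
  by apply: cvgD; [exact: cvg_cst|exact: c2].
apply: cvgD; last first.
  apply: cvgM; first exact/cM/e1.
  by apply: cvgD; [exact: cvg_cst|exact: c1].
have cF k k' : ((fun s : R * R => expR (- (k * expR (- (M1 B alpha alphaf * s.1)))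
    - k' * expR (- (M2 B alpha alphaf * s.2)))) @ t -->
    expR (- (k * expR (- (M1 B alpha alphaf * t.1)))
    - k' * expR (- (M2 B alpha alphaf * t.2))))%classic.
  by apply: cE; apply: cvgB; [apply: cvgN; exact: cM _ _ _ (e1 _)|exact: cM _ _ _ (e2 _)].
by apply: cvgD; [exact: cM _ _ _ (cF _ _)|exact: cM _ _ _ (cF _ _)].
Qed.

End Flexibility.

Local Open Scope classical_set_scope.

Theorem corollary3 (R : realType) (B alpha alphaf : R)
    (hB : 0 < B <= 1) (halpha : 0 <= alpha) (halphaf : alpha <= alphaf) :
  cvgn (matching_rate (B / 2) (B / 2) (flex_mx alpha alphaf)) /\
  exists m : R,
    is_max [set F_TS B alpha alphaf t.1 t.2 | t in `[0, 1] `*` `[0, 1]] m /\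
    eta_TS B alpha alphaf = 1 - m.
Proof.
have hb : 0 <= B / 2 <= 1 by have /andP[h1 h2] := hB; apply/andP; split; lra.
have a_law := type_prob_law hb.
have c0 := flex_mx_ge0 halpha halphaf.
have K0 : 0 <= 2 * alphaf by rewrite mulr_ge0 // (le_trans halpha).
pose A : set (R * R) := `[0, 1] `*` `[0, 1].
have A0 : A !=set0 by exists (0, 0); split; rewrite /= in_itv /= lexx ler01.
have cA : compact A by apply: compact_setX; apply: segment_compact.
have [s /set_mem sA smax] := compact_EVT_max A0 cA
  (continuous_subspaceT (@continuous_F_TS R B alpha alphaf)).
have {smax} smax t : A t -> F_TS B alpha alphaf t.1 t.2 <= F_TS B alpha alphaf s.1 s.2.
  by move=> tA; apply: smax; exact: mem_set.
have AE t : A t <-> 0 <= t.1 <= 1 /\ 0 <= t.2 <= 1.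
  by rewrite /A /= !in_itv.
have := sA; rewrite AE => -[s1 s2].
set z := exponents B alpha alphaf s.1 s.2.
have M0 := exponents_ge0 hB halpha halphaf.
have z0 x : 0 <= z x.
  have /andP[s10 _] := s1; have /andP[s20 _] := s2; have := M0 x.
  by rewrite /z /exponents !mulr1; case: ifP => _ h; rewrite mulr_ge0.
(* A maximiser of [F_TS] minimises the potential over the box, so one [z] serves both bounds in
   [rate_cvg]. *)
have zmin z' : (forall x, 0 <= z' x <= \sum_y flex_mx alpha alphaf x y * type_prob (B / 2) y) ->
    potential (type_prob (B / 2)) (type_prob (B / 2)) (fun x y => flex_mx alpha alphaf x y) z <=
    potential (type_prob (B / 2)) (type_prob (B / 2)) (fun x y => flex_mx alpha alphaf x y) z'.
  move=> hz'; have [|t1 [t2 [h1 h2 ->]]] := @exponents_cover R B alpha alphaf z'.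
    by move=> x; rewrite -load_max.
  rewrite !potential_flex lerD2l lerN2; apply: (smax (t1, t2)).
  by rewrite AE.
have lim := rate_cvg 0 a_law a_law c0 K0 z0 zmin.
have rE : matching_rate (B / 2) (B / 2) (flex_mx alpha alphaf) =
    rate (type_prob (B / 2)) (type_prob (B / 2)) (fun x y => flex_mx alpha alphaf x y).
  apply: funext => n; apply: matching_rateE => // x y.
  rewrite /edge_prob le_min ler01 /= divr_ge0 //; by have /andP[] := c0 x y.
rewrite -rE potential_flex in lim.
split; first by apply/cvg_ex; eexists; exact: lim.
exists (F_TS B alpha alphaf s.1 s.2); split.
  split; first by exists s.
  by move=> _ [t tA <-]; apply: smax.
exact: cvg_lim.
Qed.
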